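(* Let $n=p+q$ with $p,q\ge 0$, let $(\mathsf{C},\otimes_i,I_i)_{1\le i\le n}$ be an $n$-monoidal category and let $(\mathcal{T},\gamma_1,\dots,\gamma_n)$ be a $(p,q)$-monoidal monad on $\mathsf{C}$. Assume that $\mathsf{C}$ admits reflexive coequalizers and that these are preserved by $\mathcal{T}$ and by $\otimes_i$ for each $i\le p$. Then the category of $\mathcal{T}$-algebras, with the monoidal structures $$(\mathsf{C}^{\mathcal{T}},\otimes^{\gamma_1},\dots,\otimes^{\gamma_p},\otimes_{p+1},\dots,\otimes_n)$$ (and the interchange laws and unit maps described in the context), is an $n$-monoidal category.
   Context: Monoidal categories are treated as if strict. A reflexive coequalizer is a coequalizer of a pair of maps with a common section. **Duoidal category.** A category $\mathsf{C}$ with two monoidal structures $(\diamond,I)$, $(\star,J)$, a natural transformation (interchange law) $\zeta_{A,B,C,D}:(A\star B)\diamond(C\star D)\to(A\diamond C)\star(B\diamond D)$ and unit maps $\delta:I\to I\star I$, $\theta:J\diamond J\to J$, $\nu:I\to J$ such that: the two composites $(A\star X)\diamond(B\star Y)\diamond(C\star Z)\to(A\diamond B\diamond C)\star(X\diamond Y\diamond Z)$ agree, i.e. $\zeta(\zeta\diamond\mathrm{id})=\zeta(\mathrm{id}\diamond\zeta)$; the two composites $(A\star B\star C)\diamond(X\star Y\star Z)\to(A\diamond X)\star(B\diamond Y)\star(C\diamond Z)$ agree, i.e. $(\zeta\star\mathrm{id})\zeta=(\mathrm{id}\star\zeta)\zeta$; the composites $A\star B=I\diamond(A\star B)\xrightarrow{\delta\diamond\mathrm{id}}(I\star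 I)\diamond(A\star B)\xrightarrow{\zeta}(I\diamond A)\star(I\diamond B)=A\star B$ and $A\diamond B=(J\star A)\diamond(J\star B)\xrightarrow{\zeta}(J\diamond J)\star(A\diamond B)\xrightarrow{\theta\star\mathrm{id}}J\star(A\diamond B)=A\diamond B$, and their right-handed versions, are identities; $(J,\theta,\nu)$ is a monoid in $(\mathsf{C},\diamond,I)$; $(I,\delta,\nu)$ is a comonoid in $(\mathsf{C},\star,J)$. **$n$-monoidal category.** A category with $n$ monoidal structures $(\otimes_i,I_i)$ and, for each $i<j$, a duoidal structure on $(\mathsf{C},\otimes_i,I_i,\otimes_j,I_j)$ with interchange law $\zeta_{ij}$ and unit maps $\delta_{ij}:I_i\to I_i\otimes_j I_i$, $\theta_{ij}:I_j\otimes_i I_j\to I_j$, $\nu_{ij}:I_i\to I_j$, such that for all $i<j<k$ each triple is 3-monoidal, i.e.: 1. $\zeta_{jk}\circ(\zeta_{ik}\otimes_j\zeta_{ik})\circ\zeta_{ij}=(\zeta_{ij}\otimes_k\zeta_{ij})\circ\zeta_{ik}\circ(\zeta_{jk}\otimes_i\zeta_{jk})$ as maps from $((A_1\otimes_k B_1)\otimes_j(A_2\otimes_k B_2))\otimes_i((C_1\otimes_k D_1)\otimes_j(C_2\otimes_k D_2))$ to $((A_1\otimes_i C_1)\otimes_j(A_2\otimes_i C_2))\otimes_k((B_1\otimes_i D_1)\otimes_j(B_2\otimes_i D_2))$; 2. $\zeta_{jk}\circ(\delta_{ik}\otimes_j\delta_{ik})\circ\delta_{ij}=(\delta_{ij}\otimes_k\delta_{ij})\circ\delta_{ik}$;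 3. $(\theta_{ij}\otimes_k\theta_{ij})\circ\zeta_{ik}\circ(\delta_{jk}\otimes_i\delta_{jk})=\delta_{jk}\circ\theta_{ij}$; 4. $\theta_{jk}\circ(\theta_{ik}\otimes_j\theta_{ik})\circ\zeta_{ij}=\theta_{ik}\circ(\theta_{jk}\otimes_i\theta_{jk})$; 5. $(\nu_{ij}\otimes_k\nu_{ij})\circ\delta_{ik}=\delta_{jk}\circ\nu_{ij}$; 6. $\theta_{jk}\circ(\nu_{ik}\otimes_j\nu_{ik})\circ\delta_{ij}=\nu_{ik}$; 7. $\nu_{jk}\circ\theta_{ij}=\theta_{ik}\circ(\nu_{jk}\otimes_i\nu_{jk})$; 8. $\nu_{jk}\circ\nu_{ij}=\nu_{ik}$. **Monoidal and comonoidal monads.** A monad $(\mathcal{T},\mu,\eta)$ on $(\mathsf{C},\otimes,I)$ is monoidal (resp. comonoidal) if $\mathcal{T}$ carries a lax monoidal structure $\varphi_{X,Y}:\mathcal{T}X\otimes\mathcal{T}Y\to\mathcal{T}(X\otimes Y)$, $\varphi_0:I\to\mathcal{T}I$ (resp. a colax monoidal structure $\psi_{X,Y}:\mathcal{T}(X\otimes Y)\to\mathcal{T}X\otimes\mathcal{T}Y$, $\psi_0:\mathcal{T}I\to I$) for which $\mu$ and $\eta$ are morphisms of monoidal (resp. comonoidal) functors. **Monads on a duoidal category** $(\mathsf{C},\diamond,I,\star,J)$. - *Bimonoidal* $(\mathcal{T},\varphi,\psi)$: $\varphi$ makes $\mathcal{T}$ monoidal on $(\diamond,I)$, $\psi$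 makes it comonoidal on $(\star,J)$, and $(\varphi\star\varphi)\zeta(\psi\diamond\psi)=\psi\,\mathcal{T}(\zeta)\,\varphi:\mathcal{T}(A\star B)\diamond\mathcal{T}(C\star D)\to\mathcal{T}(A\diamond C)\star\mathcal{T}(B\diamond D)$; $\psi_{I,I}\mathcal{T}(\delta)\varphi_0=(\varphi_0\star\varphi_0)\delta$; $\psi_0\mathcal{T}(\theta)\varphi_{J,J}=\theta(\psi_0\diamond\psi_0)$; $\psi_0\mathcal{T}(\nu)\varphi_0=\nu$. - *Double monoidal* $(\mathcal{T},\varphi,\gamma)$: monoidal on $(\diamond,I)$ via $\varphi$ and on $(\star,J)$ via $\gamma$, and $\mathcal{T}(\zeta)\varphi(\gamma\diamond\gamma)=\gamma(\varphi\star\varphi)\zeta$; $\gamma(\varphi_0\star\varphi_0)\delta=\mathcal{T}(\delta)\varphi_0$; $\gamma_0\theta=\mathcal{T}(\theta)\varphi(\gamma_0\diamond\gamma_0)$; $\gamma_0\nu=\mathcal{T}(\nu)\varphi_0$. - *Double comonoidal* $(\mathcal{T},\chi,\psi)$: comonoidal on $(\diamond,I)$ via $\chi$ and on $(\star,J)$ via $\psi$, and $\zeta(\psi\diamond\psi)\chi=(\chi\star\chi)\psi\,\mathcal{T}(\zeta)$; $\delta\chi_0=(\chi_0\star\chi_0)\psi\,\mathcal{T}(\delta)$; $\psi_0\mathcal{T}(\theta)=\theta(\psi_0\diamond\psi_0)\chi$; $\psi_0\mathcal{T}(\nu)=\nu\chi_0$. **$(p,q)$-monoidal monad** on an $n$-monoidal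 category, $n=p+q$: a monad $\mathcal{T}$ with $n$ structures $\gamma_i$, where $\gamma_i$ makes $\mathcal{T}$ monoidal on $(\mathsf{C},\otimes_i)$ for $i\le p$ and comonoidal on $(\mathsf{C},\otimes_i)$ for $i>p$, and such that $(\mathcal{T},\gamma_i,\gamma_j)$ on $(\mathsf{C},\otimes_i,\otimes_j)$ is double monoidal if $i<j\le p$, bimonoidal if $i\le p<j$, double comonoidal if $p<i<j$. **Structures on $\mathsf{C}^{\mathcal{T}}$.** For $i\le p$, a map $f:V_1\otimes_i\cdots\otimes_i V_m\to W$ in $\mathsf{C}$ between (tensor products of) algebras $(V_s,v_s)$, $(W,w)$ is $(\mathcal{T},\gamma_i)$-multilinear if $w\circ\mathcal{T}f\circ\gamma_i=f\circ(v_1\otimes_i\cdots\otimes_i v_m)$, with $\gamma_i$ the iterated structure map. The tensor product $V_1\otimes^{\gamma_i}\cdots\otimes^{\gamma_i}V_m$ is the codomain of the universal such map $u_i$ (every multilinear map from $(V_1,\dots,V_m)$ factors uniquely through $u_i$ by an algebra morphism); it is the coequalizer in $\mathsf{C}^{\mathcal T}$ of $\mu\circ\mathcal{T}\gamma_i$ and $\mathcal{T}(v_1\otimes_i\cdots\otimes_i v_m):\mathcal{T}(\mathcal{T}V_1\otimes_i\cdots\otimes_i\mathcal{T}V_m)\to\mathcal{T}(V_1\otimes_i\cdots\otimes_i V_m)$. Under the stated hypotheses this gives a monoidal structure with unit the free algebra $\mathcal{T}I_i$. For $i>p$, $V\otimes_i W$ is an algebra via $\mathcal{T}(V\otimes_i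 W)\xrightarrow{\gamma_i}\mathcal{T}V\otimes_i\mathcal{T}W\xrightarrow{v\otimes_i w}V\otimes_i W$, and $I_i$ via $(\gamma_i)_0$; this gives a monoidal structure on $\mathsf{C}^{\mathcal{T}}$ with unit $I_i$. The interchange law $\zeta_{ij}^{\mathcal{T}}$ is: for $p<i<j$, equal to $\zeta_{ij}$ (with the same unit maps as $\mathsf{C}$). For $i\le p<j$, the unique algebra morphism with $\zeta_{ij}^{\mathcal{T}}\circ u_i=(u_i\otimes_j u_i)\circ\zeta_{ij}$; the unit maps are $\mathcal{T}I_i\xrightarrow{\mathcal{T}\delta_{ij}}\mathcal{T}(I_i\otimes_j I_i)\xrightarrow{\gamma_j}\mathcal{T}I_i\otimes_j\mathcal{T}I_i$, $\mathcal{T}I_i\xrightarrow{\mathcal{T}\nu_{ij}}\mathcal{T}I_j\xrightarrow{(\gamma_j)_0}I_j$, and the algebra morphism $I_j\otimes^{\gamma_i}I_j\to I_j$ induced by the bilinear map $\theta_{ij}$. For $i<j\le p$, the unique algebra morphism with $\zeta_{ij}^{\mathcal{T}}\circ u_i\circ(u_j\otimes_i u_j)=u_j\circ(u_i\otimes_j u_i)\circ\zeta_{ij}$; the unit maps are obtained by applying $\mathcal{T}$ to those of $\mathsf{C}$ and using the canonical isomorphisms $\mathcal{T}X\otimes^{\gamma_i}\mathcal{T}Y\cong\mathcal{T}(X\otimes_i Y)$, $\mathcal{T}X\otimes^{\gamma_j}\mathcal{T}Y\cong\mathcal{T}(X\otimes_j Y)$ induced by $\gamma_i$, $\gamma_j$.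 *)

(* Defs.v *)
From mathcomp Require Import all_boot.
From Stdlib Require Import ProofIrrelevance.

Set Implicit Arguments.
Unset Strict Implicit.
Unset Printing Implicit Defensive.

Declare Scope cat_scope.
Delimit Scope cat_scope with cat.
Local Open Scope cat_scope.

Record category := Category {
  ob :> Type;
  hom : ob -> ob -> Type;
  idm : forall A, hom A A;
  compm : forall A B D, hom B D -> hom A B -> hom A D;
  compm_idl : forall A B (f : hom A B), compm (idm B) f = f;
  compm_idr : forall A B (f : hom A B), compm f (idm A) = f;
  compmA : forall A B D E (h : hom D E) (g : hom B D) (f : hom A B),
    compm h (compm g f) = compm (compm h g) f
}.

Arguments idm {_} A.

Notation "g ∘ f" := (compm g f) (at level 40, left associativity) : cat_scope.

Definition is_iso (C : category) (A B : C) (f : hom A B) : Prop :=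
  exists g : hom B A, g ∘ f = idm A /\ f ∘ g = idm B.

Record functor (C D : category) := Functor {
  fob :> C -> D;
  fmap : forall A B : C, hom A B -> hom (fob A) (fob B);
  fmap_id : forall A, fmap (idm A) = idm (fob A);
  fmap_comp : forall (A B E : C) (g : hom B E) (f : hom A B),
    fmap (g ∘ f) = fmap g ∘ fmap f
}.

Arguments fmap {_ _} F {_ _} f : rename.

Definition reflexive_pair (C : category) (A B : C) (f g : hom A B) : Prop :=
  exists s : hom B A, f ∘ s = idm B /\ g ∘ s = idm B.

Definition is_coequalizer (C : category) (A B Q : C) (f g : hom A B)
    (e : hom B Q) : Prop :=
  e ∘ f = e ∘ g /\
  forall (X : C) (h : hom B X), h ∘ f = h ∘ g -> exists! k : hom Q X, k ∘ e = h.

Definition has_reflexive_coequalizers (C : category) : Prop :=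
  forall (A B : C) (f g : hom A B), reflexive_pair f g ->
    exists (Q : C) (e : hom B Q), is_coequalizer f g e.

Definition preserves_reflexive_coequalizers (C D : category)
    (F : functor C D) : Prop :=
  forall (A B Q : C) (f g : hom A B) (e : hom B Q),
    reflexive_pair f g -> is_coequalizer f g e ->
    is_coequalizer (fmap F f) (fmap F g) (fmap F e).

(* The tensor product of objects and the unit are parameters and not fields, so
   that a statement can prescribe them on the nose.  Associators and unitors
   are explicit, here and below, wherever strictness would suppress them. *)
Record monoidal (C : category) (tens : C -> C -> C) (I : C) := Monoidal {
  tensm : forall A A' B B' : C,
    hom A A' -> hom B B' -> hom (tens A B) (tens A' B');
  assoc : forall A B D : C, hom (tens (tens A B) D) (tens A (tens B D));
  lunit : forall A : C, hom (tens I A) A;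
  runit : forall A : C, hom (tens A I) A;
  tensm_id : forall A B : C, tensm (idm A) (idm B) = idm (tens A B);
  tensm_comp : forall (A A' A'' B B' B'' : C)
    (f' : hom A' A'') (f : hom A A') (g' : hom B' B'') (g : hom B B'),
    tensm (f' ∘ f) (g' ∘ g) = tensm f' g' ∘ tensm f g;
  assoc_nat : forall (A A' B B' D D' : C)
    (f : hom A A') (g : hom B B') (h : hom D D'),
    assoc A' B' D' ∘ tensm (tensm f g) h = tensm f (tensm g h) ∘ assoc A B D;
  lunit_nat : forall (A A' : C) (f : hom A A'),
    lunit A' ∘ tensm (idm I) f = f ∘ lunit A;
  runit_nat : forall (A A' : C) (f : hom A A'),
    runit A' ∘ tensm f (idm I) = f ∘ runit A;
  assoc_iso : forall A B D : C, is_iso (assoc A B D);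
  lunit_iso : forall A : C, is_iso (lunit A);
  runit_iso : forall A : C, is_iso (runit A);
  pentagon : forall A B D E : C,
    assoc A B (tens D E) ∘ assoc (tens A B) D E =
    tensm (idm A) (assoc B D E) ∘ assoc A (tens B D) E
      ∘ tensm (assoc A B D) (idm E);
  triangle : forall A B : C,
    tensm (idm A) (lunit B) ∘ assoc A I B = tensm (runit A) (idm B)
}.

Notation "f ⊗[ M ] g" := (tensm M f g)
  (at level 38, M at level 200, left associativity, format "f  ⊗[ M ]  g")
  : cat_scope.

Section TensorFunctors.
Context (C : category) (tens : C -> C -> C) (I : C) (M : monoidal tens I).

Definition ltens (A : C) : functor C C.
Proof.
refine (@Functor C C (tens A) (fun B B' f => idm A ⊗[M] f) _ _).
- by move=> B; rewrite tensm_id.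
- by move=> B B' B'' g f; rewrite -tensm_comp compm_idl.
Defined.

Definition rtens (A : C) : functor C C.
Proof.
refine (@Functor C C (fun B => tens B A) (fun B B' f => f ⊗[M] idm A) _ _).
- by move=> B; rewrite tensm_id.
- by move=> B B' B'' g f; rewrite -tensm_comp compm_idl.
Defined.

End TensorFunctors.

Record duoidal (C : category)
    (dia : C -> C -> C) (I : C) (M : monoidal dia I)
    (star : C -> C -> C) (J : C) (N : monoidal star J) := Duoidal {
  zeta : forall A B D E : C,
    hom (dia (star A B) (star D E)) (star (dia A D) (dia B E));
  delta : hom I (star I I);
  theta : hom (dia J J) J;
  nu : hom I J;
  zeta_nat : forall (A A' B B' D D' E E' : C)
    (a : hom A A') (b : hom B B') (d : hom D D') (e : hom E E'),
    zeta A' B' D' E' ∘ ((a ⊗[N] b) ⊗[M] (d ⊗[N] e)) =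
    ((a ⊗[M] d) ⊗[N] (b ⊗[M] e)) ∘ zeta A B D E;
  zeta_assoc_dia : forall A B D X Y Z : C,
    (assoc M A B D ⊗[N] assoc M X Y Z)
      ∘ zeta (dia A B) (dia X Y) D Z ∘ (zeta A X B Y ⊗[M] idm (star D Z)) =
    zeta A X (dia B D) (dia Y Z) ∘ (idm (star A X) ⊗[M] zeta B Y D Z)
      ∘ assoc M (star A X) (star B Y) (star D Z);
  zeta_assoc_star : forall A B D X Y Z : C,
    assoc N (dia A X) (dia B Y) (dia D Z)
      ∘ (zeta A B X Y ⊗[N] idm (dia D Z)) ∘ zeta (star A B) D (star X Y) Z =
    (idm (dia A X) ⊗[N] zeta B D Y Z) ∘ zeta A (star B D) X (star Y Z)
      ∘ (assoc N A B D ⊗[M] assoc N X Y Z);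
  zeta_delta_l : forall A B : C,
    (lunit M A ⊗[N] lunit M B) ∘ zeta I I A B ∘ (delta ⊗[M] idm (star A B)) =
    lunit M (star A B);
  zeta_delta_r : forall A B : C,
    (runit M A ⊗[N] runit M B) ∘ zeta A B I I ∘ (idm (star A B) ⊗[M] delta) =
    runit M (star A B);
  zeta_theta_l : forall A B : C,
    lunit N (dia A B) ∘ (theta ⊗[N] idm (dia A B)) ∘ zeta J A J B =
    lunit N A ⊗[M] lunit N B;
  zeta_theta_r : forall A B : C,
    runit N (dia A B) ∘ (idm (dia A B) ⊗[N] theta) ∘ zeta A J B J =
    runit N A ⊗[M] runit N B;
  theta_assoc :
    theta ∘ (theta ⊗[M] idm J) = theta ∘ (idm J ⊗[M] theta) ∘ assoc M J J J;
  theta_nu_l : theta ∘ (nu ⊗[M] idm J) = lunit M J;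
  theta_nu_r : theta ∘ (idm J ⊗[M] nu) = runit M J;
  delta_coassoc :
    assoc N I I I ∘ (delta ⊗[N] idm I) ∘ delta = (idm I ⊗[N] delta) ∘ delta;
  delta_nu_l : lunit N I ∘ (nu ⊗[N] idm I) ∘ delta = idm I;
  delta_nu_r : runit N I ∘ (idm I ⊗[N] nu) ∘ delta = idm I
}.

Record trimonoidal (C : category)
    (ti : C -> C -> C) (Ii : C) (Mi : monoidal ti Ii)
    (tj : C -> C -> C) (Ij : C) (Mj : monoidal tj Ij)
    (tk : C -> C -> C) (Ik : C) (Mk : monoidal tk Ik)
    (Dij : duoidal Mi Mj) (Dik : duoidal Mi Mk) (Djk : duoidal Mj Mk)
    : Prop := Trimonoidal {
  tri_zeta : forall A1 A2 B1 B2 D1 D2 E1 E2 : C,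
    zeta Djk (ti A1 D1) (ti B1 E1) (ti A2 D2) (ti B2 E2)
      ∘ (zeta Dik A1 B1 D1 E1 ⊗[Mj] zeta Dik A2 B2 D2 E2)
      ∘ zeta Dij (tk A1 B1) (tk A2 B2) (tk D1 E1) (tk D2 E2) =
    (zeta Dij A1 A2 D1 D2 ⊗[Mk] zeta Dij B1 B2 E1 E2)
      ∘ zeta Dik (tj A1 A2) (tj B1 B2) (tj D1 D2) (tj E1 E2)
      ∘ (zeta Djk A1 B1 A2 B2 ⊗[Mi] zeta Djk D1 E1 D2 E2);
  tri_zeta_delta :
    zeta Djk Ii Ii Ii Ii ∘ (delta Dik ⊗[Mj] delta Dik) ∘ delta Dij =
    (delta Dij ⊗[Mk] delta Dij) ∘ delta Dik;
  tri_theta_delta :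
    (theta Dij ⊗[Mk] theta Dij) ∘ zeta Dik Ij Ij Ij Ij
      ∘ (delta Djk ⊗[Mi] delta Djk) =
    delta Djk ∘ theta Dij;
  tri_theta_zeta :
    theta Djk ∘ (theta Dik ⊗[Mj] theta Dik) ∘ zeta Dij Ik Ik Ik Ik =
    theta Dik ∘ (theta Djk ⊗[Mi] theta Djk);
  tri_nu_delta : (nu Dij ⊗[Mk] nu Dij) ∘ delta Dik = delta Djk ∘ nu Dij;
  tri_theta_nu_delta : theta Djk ∘ (nu Dik ⊗[Mj] nu Dik) ∘ delta Dij = nu Dik;
  tri_nu_theta : nu Djk ∘ theta Dij = theta Dik ∘ (nu Djk ⊗[Mi] nu Djk);
  tri_nu_nu : nu Djk ∘ nu Dij = nu Dik
}.

(* The n monoidal structures are labelled by a type X, ordered by a bijection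
   pos onto {0, ..., n-1}.  For n = p + q we shall use X = 'I_p + 'I_q and
   pos = unsplit, so that inl i is the (i+1)-st structure and inr j is the
   (p+j+1)-st: objects can then be given by plain case analysis on the label. *)
Record n_monoidal (n : nat) (X : Type) (pos : X -> 'I_n) (C : category)
    (tens : X -> C -> C -> C) (I : X -> C) := NMonoidal {
  pos_bij : bijective pos;
  mon : forall i : X, monoidal (tens i) (I i);
  duo : forall i j : X, pos i < pos j -> duoidal (mon i) (mon j);
  tri : forall (i j k : X)
    (ij : pos i < pos j) (ik : pos i < pos k) (jk : pos j < pos k),
    trimonoidal (duo ij) (duo ik) (duo jk)
}.

Record monad (C : category) := Monad {
  mfun :> functor C C;
  mu : forall A : C, hom (mfun (mfun A)) (mfun A);
  eta : forall A : C, hom A (mfun A);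
  mu_nat : forall (A B : C) (f : hom A B),
    mu B ∘ fmap mfun (fmap mfun f) = fmap mfun f ∘ mu A;
  eta_nat : forall (A B : C) (f : hom A B), eta B ∘ f = fmap mfun f ∘ eta A;
  mu_assoc : forall A : C, mu A ∘ fmap mfun (mu A) = mu A ∘ mu (mfun A);
  mu_eta_l : forall A : C, mu A ∘ eta (mfun A) = idm (mfun A);
  mu_eta_r : forall A : C, mu A ∘ fmap mfun (eta A) = idm (mfun A)
}.

Arguments mu {_} T A : rename.
Arguments eta {_} T A : rename.

Section Algebras.
Context (C : category) (T : monad C).

Record algebra := Algebra {
  carrier :> C;
  act : hom (T carrier) carrier;
  act_mu : act ∘ mu T carrier = act ∘ fmap T act;
  act_eta : act ∘ eta T carrier = idm carrier
}.

Record alg_hom (V W : algebra) := AlgHom {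
  alg_map :> hom V W;
  alg_mapP : alg_map ∘ act V = act W ∘ fmap T alg_map
}.

Lemma alg_hom_inj (V W : algebra) (f g : alg_hom V W) :
  alg_map f = alg_map g -> f = g.
Proof.
case: f g => [f Hf] [g Hg] /= E; subst g.
by rewrite (proof_irrelevance _ Hf Hg).
Qed.

Definition alg_id (V : algebra) : alg_hom V V.
Proof. by exists (idm V); rewrite fmap_id compm_idl compm_idr. Defined.

Definition alg_comp (V W Z : algebra) (g : alg_hom W Z) (f : alg_hom V W) :
  alg_hom V Z.
Proof.
exists (alg_map g ∘ alg_map f).
by rewrite fmap_comp -compmA alg_mapP !compmA alg_mapP.
Defined.

Definition EM : category.
Proof.
refine (@Category algebra alg_hom alg_id alg_comp _ _ _).
- by move=> V W f; apply: alg_hom_inj; rewrite /= compm_idl.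
- by move=> V W f; apply: alg_hom_inj; rewrite /= compm_idr.
- by move=> V W Z Z' h g f; apply: alg_hom_inj; rewrite /= compmA.
Defined.

Definition free_alg (A : C) : algebra.
Proof.
exists (T A) (mu T A); first by rewrite mu_assoc.
by rewrite mu_eta_l.
Defined.

End Algebras.

Record monoidal_monad (C : category) (tens : C -> C -> C) (I : C)
    (M : monoidal tens I) (T : monad C) := MonoidalMonad {
  lax : forall A B : C, hom (tens (T A) (T B)) (T (tens A B));
  lax0 : hom I (T I);
  lax_nat : forall (A A' B B' : C) (f : hom A A') (g : hom B B'),
    lax A' B' ∘ (fmap T f ⊗[M] fmap T g) = fmap T (f ⊗[M] g) ∘ lax A B;
  lax_assoc : forall A B D : C,
    fmap T (assoc M A B D) ∘ lax (tens A B) D ∘ (lax A B ⊗[M] idm (T D)) =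
    lax A (tens B D) ∘ (idm (T A) ⊗[M] lax B D) ∘ assoc M (T A) (T B) (T D);
  lax_lunit : forall A : C,
    fmap T (lunit M A) ∘ lax I A ∘ (lax0 ⊗[M] idm (T A)) = lunit M (T A);
  lax_runit : forall A : C,
    fmap T (runit M A) ∘ lax A I ∘ (idm (T A) ⊗[M] lax0) = runit M (T A);
  lax_mu : forall A B : C,
    mu T (tens A B) ∘ fmap T (lax A B) ∘ lax (T A) (T B) =
    lax A B ∘ (mu T A ⊗[M] mu T B);
  lax0_mu : mu T I ∘ fmap T lax0 ∘ lax0 = lax0;
  lax_eta : forall A B : C, lax A B ∘ (eta T A ⊗[M] eta T B) = eta T (tens A B);
  lax0_eta : lax0 = eta T I
}.

Record comonoidal_monad (C : category) (tens : C -> C -> C) (I : C)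
    (M : monoidal tens I) (T : monad C) := ComonoidalMonad {
  colax : forall A B : C, hom (T (tens A B)) (tens (T A) (T B));
  colax0 : hom (T I) I;
  colax_nat : forall (A A' B B' : C) (f : hom A A') (g : hom B B'),
    colax A' B' ∘ fmap T (f ⊗[M] g) = (fmap T f ⊗[M] fmap T g) ∘ colax A B;
  colax_assoc : forall A B D : C,
    assoc M (T A) (T B) (T D) ∘ (colax A B ⊗[M] idm (T D)) ∘ colax (tens A B) D =
    (idm (T A) ⊗[M] colax B D) ∘ colax A (tens B D) ∘ fmap T (assoc M A B D);
  colax_lunit : forall A : C,
    lunit M (T A) ∘ (colax0 ⊗[M] idm (T A)) ∘ colax I A = fmap T (lunit M A);
  colax_runit : forall A : C,
    runit M (T A) ∘ (idm (T A) ⊗[M] colax0) ∘ colax A I = fmap T (runit M A);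
  colax_mu : forall A B : C,
    colax A B ∘ mu T (tens A B) =
    (mu T A ⊗[M] mu T B) ∘ colax (T A) (T B) ∘ fmap T (colax A B);
  colax0_mu : colax0 ∘ mu T I = colax0 ∘ fmap T colax0;
  colax_eta : forall A B : C,
    colax A B ∘ eta T (tens A B) = eta T A ⊗[M] eta T B;
  colax0_eta : colax0 ∘ eta T I = idm I
}.

Section MonadsOnDuoidal.
Context (C : category).
Context (dia : C -> C -> C) (I : C) (M : monoidal dia I).
Context (star : C -> C -> C) (J : C) (N : monoidal star J).
Context (D : duoidal M N) (T : monad C).

Record bimonoidal (phi : monoidal_monad M T) (psi : comonoidal_monad N T)
    : Prop := Bimonoidal {
  bi_zeta : forall A B X Y : C,
    (lax phi A X ⊗[N] lax phi B Y) ∘ zeta D (T A) (T B) (T X) (T Y)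
      ∘ (colax psi A B ⊗[M] colax psi X Y) =
    colax psi (dia A X) (dia B Y) ∘ fmap T (zeta D A B X Y)
      ∘ lax phi (star A B) (star X Y);
  bi_delta :
    colax psi I I ∘ fmap T (delta D) ∘ lax0 phi =
    (lax0 phi ⊗[N] lax0 phi) ∘ delta D;
  bi_theta :
    colax0 psi ∘ fmap T (theta D) ∘ lax phi J J =
    theta D ∘ (colax0 psi ⊗[M] colax0 psi);
  bi_nu : colax0 psi ∘ fmap T (nu D) ∘ lax0 phi = nu D
}.

Record double_monoidal (phi : monoidal_monad M T) (gam : monoidal_monad N T)
    : Prop := DoubleMonoidal {
  dm_zeta : forall A B X Y : C,
    fmap T (zeta D A B X Y) ∘ lax phi (star A B) (star X Y)
      ∘ (lax gam A B ⊗[M] lax gam X Y) =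
    lax gam (dia A X) (dia B Y) ∘ (lax phi A X ⊗[N] lax phi B Y)
      ∘ zeta D (T A) (T B) (T X) (T Y);
  dm_delta :
    lax gam I I ∘ (lax0 phi ⊗[N] lax0 phi) ∘ delta D =
    fmap T (delta D) ∘ lax0 phi;
  dm_theta :
    lax0 gam ∘ theta D =
    fmap T (theta D) ∘ lax phi J J ∘ (lax0 gam ⊗[M] lax0 gam);
  dm_nu : lax0 gam ∘ nu D = fmap T (nu D) ∘ lax0 phi
}.

Record double_comonoidal (chi : comonoidal_monad M T)
    (psi : comonoidal_monad N T) : Prop := DoubleComonoidal {
  dc_zeta : forall A B X Y : C,
    zeta D (T A) (T B) (T X) (T Y) ∘ (colax psi A B ⊗[M] colax psi X Y)
      ∘ colax chi (star A B) (star X Y) =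
    (colax chi A X ⊗[N] colax chi B Y) ∘ colax psi (dia A X) (dia B Y)
      ∘ fmap T (zeta D A B X Y);
  dc_delta :
    delta D ∘ colax0 chi =
    (colax0 chi ⊗[N] colax0 chi) ∘ colax psi I I ∘ fmap T (delta D);
  dc_theta :
    colax0 psi ∘ fmap T (theta D) =
    theta D ∘ (colax0 psi ⊗[M] colax0 psi) ∘ colax chi J J;
  dc_nu : colax0 psi ∘ fmap T (nu D) = nu D ∘ colax0 chi
}.

End MonadsOnDuoidal.

Record pq_monoidal_monad (p q : nat) (C : category)
    (tens : 'I_p + 'I_q -> C -> C -> C) (I : 'I_p + 'I_q -> C)
    (N : n_monoidal (@unsplit p q) tens I) (T : monad C) := PQMonoidalMonad {
  gaml : forall i : 'I_p, monoidal_monad (mon N (inl i)) T;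
  gamr : forall j : 'I_q, comonoidal_monad (mon N (inr j)) T;
  gam_ll : forall (i i' : 'I_p) (h : unsplit (inl i) < unsplit (inl i')),
    double_monoidal (duo N h) (gaml i) (gaml i');
  gam_lr : forall (i : 'I_p) (j : 'I_q) (h : unsplit (inl i) < unsplit (inr j)),
    bimonoidal (duo N h) (gaml i) (gamr j);
  gam_rr : forall (j j' : 'I_q) (h : unsplit (inr j) < unsplit (inr j')),
    double_comonoidal (duo N h) (gamr j) (gamr j')
}.

Section Bilinear.
Context (C : category) (tens : C -> C -> C) (I : C) (M : monoidal tens I).
Context (T : monad C) (phi : monoidal_monad M T).

Definition bilinear (V W Z : algebra T) (f : hom (tens V W) Z) : Prop :=
  act Z ∘ fmap T f ∘ lax phi V W = f ∘ (act V ⊗[M] act W).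

Definition universal_bilinear (V W Z : algebra T) (u : hom (tens V W) Z)
    : Prop :=
  bilinear u /\
  forall (X : algebra T) (f : hom (tens V W) X), bilinear f ->
    exists! g : alg_hom Z X, alg_map g ∘ u = f.

(* k is the canonical isomorphism from a tensor product (Z, u) of the free
   algebras on A and B to the free algebra on the tensor product of A and B. *)
Definition free_tens_iso (A B : C) (Z : algebra T)
    (u : hom (tens (free_alg T A) (free_alg T B)) Z)
    (k : hom (Z : EM T) (free_alg T (tens A B))) : Prop :=
  is_iso k /\ alg_map k ∘ u = lax phi A B.

End Bilinear.

Section ComonoidalTensor.
Context (C : category) (tens : C -> C -> C) (I : C) (M : monoidal tens I).
Context (T : monad C) (psi : comonoidal_monad M T).

Definition cotens_alg (V W : algebra T) : algebra T.
Proof.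
exists (tens V W) ((act V ⊗[M] act W) ∘ colax psi V W).
- rewrite -compmA colax_mu !compmA -tensm_comp !act_mu tensm_comp.
  by rewrite -(compmA (act V ⊗[M] act W)) -colax_nat fmap_comp !compmA.
- by rewrite -compmA colax_eta -tensm_comp !act_eta tensm_id.
Defined.

Definition counit_alg : algebra T.
Proof.
exists I (colax0 psi); first exact: colax0_mu.
exact: colax0_eta.
Defined.

End ComonoidalTensor.

Section LiftedStructure.
Context (p q : nat) (C : category).
Context (tens : 'I_p + 'I_q -> C -> C -> C) (I : 'I_p + 'I_q -> C).
Context (N : n_monoidal (@unsplit p q) tens I).
Context (T : monad C) (G : pq_monoidal_monad N T).

(* tp i V W is a chosen tensor product of V and W over gaml G i. *)
Context (tp : 'I_p -> algebra T -> algebra T -> algebra T).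

Definition alg_tens (s : 'I_p + 'I_q) (V W : algebra T) : algebra T :=
  match s with
  | inl i => tp i V W
  | inr j => cotens_alg (gamr G j) V W
  end.

Definition alg_unit (s : 'I_p + 'I_q) : algebra T :=
  match s with
  | inl i => free_alg T (I (inl i))
  | inr j => counit_alg (gamr G j)
  end.

Context (u : forall (i : 'I_p) (V W : algebra T),
           hom (tens (inl i) V W) (tp i V W)).
Context (NT : n_monoidal (C := EM T) (@unsplit p q) alg_tens alg_unit).

(* The structure of C^T for the first p tensor products: morphisms and
   constraints are those induced from C along the universal bilinear maps.
   The unitor TI ⊗ V -> V is induced by the bilinear map
   TI ⊗ V -> TI ⊗ TV -> T(I ⊗ V) = TV -> V. *)
Record lifted_monoidal_l (i : 'I_p) (M := mon N (inl i))
    (MT := mon NT (inl i)) : Prop := LiftedMonoidalL {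
  liftl_tensm : forall (V V' W W' : algebra T)
    (f : alg_hom V V') (g : alg_hom W W'),
    alg_map (tensm MT f g) ∘ u i V W
    = u i V' W' ∘ (alg_map f ⊗[M] alg_map g);
  liftl_assoc : forall V W Z : algebra T,
    alg_map (assoc MT V W Z) ∘ u i (tp i V W) Z ∘ (u i V W ⊗[M] idm (Z : C))
    = u i V (tp i W Z) ∘ (idm (V : C) ⊗[M] u i W Z) ∘ assoc M V W Z;
  liftl_lunit : forall V : algebra T,
    alg_map (lunit MT V) ∘ u i (free_alg T (I (inl i))) V
    = act V ∘ fmap T (lunit M V) ∘ lax (gaml G i) (I (inl i)) V
        ∘ (idm (T (I (inl i))) ⊗[M] eta T V);
  liftl_runit : forall V : algebra T,
    alg_map (runit MT V) ∘ u i V (free_alg T (I (inl i)))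
    = act V ∘ fmap T (runit M V) ∘ lax (gaml G i) V (I (inl i))
        ∘ (eta T V ⊗[M] idm (T (I (inl i))))
}.

Record lifted_monoidal_r (j : 'I_q) (M := mon N (inr j))
    (MT := mon NT (inr j)) : Prop := LiftedMonoidalR {
  liftr_tensm : forall (V V' W W' : algebra T)
    (f : alg_hom V V') (g : alg_hom W W'),
    alg_map (tensm MT f g) = alg_map f ⊗[M] alg_map g;
  liftr_assoc : forall V W Z : algebra T,
    alg_map (assoc MT V W Z) = assoc M V W Z;
  liftr_lunit : forall V : algebra T, alg_map (lunit MT V) = lunit M V;
  liftr_runit : forall V : algebra T, alg_map (runit MT V) = runit M V
}.

Record lifted_duoidal_ll (i j : 'I_p)
    (h : unsplit (inl i) < unsplit (inl j))
    (Mi := mon N (inl i)) (Mj := mon N (inl j))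
    (D := duo N h) (DT := duo NT h) : Prop := LiftedDuoidalLL {
  liftll_zeta : forall A B V W : algebra T,
    unique (fun z : alg_hom (tp i (tp j A B) (tp j V W))
                            (tp j (tp i A V) (tp i B W)) =>
        alg_map z ∘ u i (tp j A B) (tp j V W) ∘ (u j A B ⊗[Mi] u j V W)
        = u j (tp i A V) (tp i B W) ∘ (u i A V ⊗[Mj] u i B W) ∘ zeta D A B V W)
      (zeta DT A B V W);
  liftll_delta :
    exists k : alg_hom (tp j (free_alg T (I (inl i))) (free_alg T (I (inl i))))
                       (free_alg T (tens (inl j) (I (inl i)) (I (inl i)))),
      free_tens_iso (gaml G j) (u j _ _) k
      /\ alg_map k ∘ alg_map (delta DT) = fmap T (delta D);
  liftll_theta :
    exists k : alg_hom (tp i (free_alg T (I (inl j))) (free_alg T (I (inl j))))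
                       (free_alg T (tens (inl i) (I (inl j)) (I (inl j)))),
      free_tens_iso (gaml G i) (u i _ _) k
      /\ alg_map (theta DT) = fmap T (theta D) ∘ alg_map k;
  liftll_nu : alg_map (nu DT) = fmap T (nu D)
}.

Record lifted_duoidal_lr (i : 'I_p) (j : 'I_q)
    (h : unsplit (inl i) < unsplit (inr j))
    (Mj := mon N (inr j)) (D := duo N h) (DT := duo NT h)
    : Prop := LiftedDuoidalLR {
  liftlr_zeta : forall A B V W : algebra T,
    unique (fun z : alg_hom (tp i (cotens_alg (gamr G j) A B)
                                  (cotens_alg (gamr G j) V W))
                            (cotens_alg (gamr G j) (tp i A V) (tp i B W)) =>
        alg_map z ∘ u i (cotens_alg (gamr G j) A B) (cotens_alg (gamr G j) V W)
        = (u i A V ⊗[Mj] u i B W) ∘ zeta D A B V W)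
      (zeta DT A B V W);
  liftlr_delta :
    alg_map (delta DT) =
    colax (gamr G j) (I (inl i)) (I (inl i)) ∘ fmap T (delta D);
  liftlr_theta :
    alg_map (theta DT) ∘ u i (counit_alg (gamr G j)) (counit_alg (gamr G j))
    = theta D;
  liftlr_nu : alg_map (nu DT) = colax0 (gamr G j) ∘ fmap T (nu D)
}.

Record lifted_duoidal_rr (i j : 'I_q)
    (h : unsplit (inr i) < unsplit (inr j))
    (D := duo N h) (DT := duo NT h) : Prop := LiftedDuoidalRR {
  liftrr_zeta : forall A B V W : algebra T,
    alg_map (zeta DT A B V W) = zeta D A B V W;
  liftrr_delta : alg_map (delta DT) = delta D;
  liftrr_theta : alg_map (theta DT) = theta D;
  liftrr_nu : alg_map (nu DT) = nu D
}.

Record lifted_structure : Prop := LiftedStructure {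
  lifted_l : forall i : 'I_p, lifted_monoidal_l i;
  lifted_r : forall j : 'I_q, lifted_monoidal_r j;
  lifted_ll : forall (i j : 'I_p)
    (h : unsplit (inl i) < unsplit (inl j)), lifted_duoidal_ll h;
  lifted_lr : forall (i : 'I_p) (j : 'I_q)
    (h : unsplit (inl i) < unsplit (inr j)), lifted_duoidal_lr h;
  lifted_rr : forall (i j : 'I_q)
    (h : unsplit (inr i) < unsplit (inr j)), lifted_duoidal_rr h
}.

End LiftedStructure.

(* Main.v *)
(* A tensor product of algebras for i <= p is a reflection: a "presentation" of
   an object A of C consists of maps src -> TA and src -> A with a common
   section, and presents the algebra obtained as the coequalizer of the induced
   pair T(src) => TA.  Tensor products of presentations are computed in C, and a
   tensor product of algebras is the reflection into C^T of the tensor product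
   of their canonical presentations.  Since T and the tensor products preserve
   reflexive coequalizers, tensoring two reflection maps and composing with the
   universal bilinear map gives again a reflection map.  Hence every iterated
   tensor product of algebras receives a map r from the corresponding tensor
   product in C along which morphisms of algebras are determined.  All structure
   morphisms of C^T restrict along such maps to those of C, so that each axiom of
   C^T follows from the same axiom of C. *)
Require Import Defs.
From mathcomp Require Import all_boot.
From Stdlib Require Import IndefiniteDescription.

Set Implicit Arguments.
Unset Strict Implicit.
Unset Printing Implicit Defensive.

Local Open Scope cat_scope.

(** * Epimorphisms, isomorphisms and coequalizers *)

Section Composition.
Context (C : category).

Lemma compm2 (A B D E : C) (b : hom D E) (a : hom B D) (h : hom B E)
    (k : hom A B) : b ∘ a = h -> b ∘ (a ∘ k) = h ∘ k.
Proof. by move=> <-; rewrite compmA. Qed.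

Lemma compm3 (A B D E F : C) (c : hom E F) (b : hom D E) (a : hom B D)
    (h : hom B F) (k : hom A B) :
  c ∘ b ∘ a = h -> c ∘ (b ∘ (a ∘ k)) = h ∘ k.
Proof. by move=> <-; rewrite !compmA. Qed.

Definition epi (A B : C) (e : hom A B) : Prop :=
  forall (X : C) (h k : hom B X), h ∘ e = k ∘ e -> h = k.

Lemma coequalizer_epi (A B Q : C) (f g : hom A B) (e : hom B Q) :
  is_coequalizer f g e -> epi e.
Proof.
move=> [He U] X h k E.
have Hh : h ∘ e ∘ f = h ∘ e ∘ g by rewrite -!compmA He.
by have [m [_ Um]] := U X _ Hh; rewrite -(Um h erefl) -(Um k (esym E)).
Qed.

Lemma coequalizer_iso (A B Q Q' : C) (f g : hom A B) (e : hom B Q)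
    (k : hom Q Q') :
  is_coequalizer f g e -> is_iso k -> is_coequalizer f g (k ∘ e).
Proof.
move=> [He U] [k' [k'k kk']]; split; first by rewrite -!compmA He.
move=> X h Hh; have [m [Hm Um]] := U X h Hh; exists (m ∘ k'); split.
  by rewrite -compmA (compm2 _ k'k) compm_idl.
by move=> n Hn; rewrite (Um (n ∘ k)) -?compmA // kk' compm_idr.
Qed.

Lemma is_iso_id (A : C) : is_iso (idm A).
Proof. by exists (idm A); rewrite compm_idl. Qed.

Lemma is_iso_epi (A B : C) (f : hom A B) : is_iso f -> epi f.
Proof.
move=> [f' [_ ff']] X h k E.
by rewrite -(compm_idr h) -(compm_idr k) -ff' !compmA E.
Qed.

Lemma reflexive_pair_fmap (D : category) (F : functor C D) (A B : C)
    (f g : hom A B) :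
  reflexive_pair f g -> reflexive_pair (fmap F f) (fmap F g).
Proof.
by move=> [s [fs gs]]; exists (fmap F s); rewrite -!fmap_comp fs gs fmap_id.
Qed.

Lemma is_iso_tensm (tens : C -> C -> C) (I : C) (M : monoidal tens I)
    (A A' B B' : C) (f : hom A A') (g : hom B B') :
  is_iso f -> is_iso g -> is_iso (f ⊗[M] g).
Proof.
move=> [f' [f'f ff']] [g' [g'g gg']]; exists (f' ⊗[M] g').
by rewrite -!tensm_comp f'f ff' g'g gg' !tensm_id.
Qed.

End Composition.

(** * Presentations and the algebras that they present *)

Section Presentations.
Context (C : category) (T : monad C).

Lemma fmap2 (A B D E : C) (g : hom B D) (f : hom A B) (k : hom E (T A)) :
  fmap T g ∘ (fmap T f ∘ k) = fmap T (g ∘ f) ∘ k.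
Proof. by rewrite fmap_comp compmA. Qed.

(* A presents the algebra obtained as the reflexive coequalizer of the maps
   T(src) -> TA adjoint to pl and eta . pa; linear maps out of A are the
   algebra morphisms out of it.  An algebra V has the presentation
   (TV, id, act), and a tensor product of algebras (TV ⊗ TW, lax, act ⊗ act). *)
Record presentation (A : C) := Presentation {
  src : C;
  pl : hom src (T A);
  pa : hom src A;
  ps : hom A src;
  pa_s : pa ∘ ps = idm A;
  pl_s : pl ∘ ps = eta T A
}.

Definition linear (A : C) (P : presentation A) (X : algebra T) (f : hom A X)
    : Prop :=
  act X ∘ fmap T f ∘ pl P = f ∘ pa P.

(** For [discrete_pres] this is the universal property of a free algebra, for a tensor product of
    canonical presentations that of a universal bilinear map. *)
Definition reflects (A : C) (P : presentation A) (Q : algebra T)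
    (r : hom A Q) : Prop :=
  linear P r /\
  forall (X : algebra T) (f : hom A X), linear P f ->
    exists! g : alg_hom Q X, alg_map g ∘ r = f.

Definition pres_map (A B : C) (P : presentation A) (P' : presentation B)
    (f : hom A B) : Prop :=
  exists f' : hom (src P) (src P'),
    fmap T f ∘ pl P = pl P' ∘ f' /\ f ∘ pa P = pa P' ∘ f'.

Definition alg_pres (V : algebra T) : presentation V.
Proof.
exists (T V) (idm _) (act V) (eta T V); first exact: act_eta.
by rewrite compm_idl.
Defined.

(** Presents the free algebra on [A]: both maps of the induced pair are the identity of [T A]. *)
Definition discrete_pres (A : C) : presentation A.
Proof.
by exists A (eta T A) (idm A) (idm A); rewrite compm_idr.
Defined.

Lemma linear_comp (A B : C) (P : presentation A) (P' : presentation B)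
    (X : algebra T) (f : hom A B) (g : hom B X) :
  pres_map P P' f -> linear P' g -> linear P (g ∘ f).
Proof.
move=> [f' [Hl Ha]] Hg; rewrite /linear fmap_comp -!compmA Hl Ha.
by rewrite (compm3 _ Hg) -!compmA.
Qed.

Lemma linear_alg (A : C) (P : presentation A) (X Y : algebra T)
    (f : hom A X) (g : alg_hom X Y) :
  linear P f -> linear P (alg_map g ∘ f).
Proof.
move=> Hf; rewrite /linear fmap_comp -!compmA -Hf !compmA.
by rewrite -(alg_mapP g).
Qed.

Lemma pres_map_linear (A : C) (P : presentation A) (X : algebra T)
    (f : hom A X) : linear P f -> pres_map P (alg_pres X) f.
Proof.
by move=> Hf; exists (fmap T f ∘ pl P); rewrite /= compm_idl compmA Hf.
Qed.

Lemma pres_map_id (A : C) (P : presentation A) : pres_map P P (idm A).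
Proof. by exists (idm _); rewrite fmap_id !compm_idl !compm_idr. Qed.

Lemma linear_discrete (A : C) (X : algebra T) (f : hom A X) :
  linear (discrete_pres A) f.
Proof.
by rewrite /linear /= compm_idr -compmA -eta_nat compmA act_eta compm_idl.
Qed.

Lemma linear_alg_hom (V X : algebra T) (g : alg_hom V X) :
  linear (alg_pres V) (alg_map g).
Proof. by rewrite /linear /= compm_idr alg_mapP. Qed.

Lemma reflects_inj (A : C) (P : presentation A) (Q : algebra T) (r : hom A Q)
    (X : algebra T) (g g' : alg_hom Q X) :
  reflects P r -> alg_map g ∘ r = alg_map g' ∘ r -> g = g'.
Proof.
move=> [Hr U] E.
have [m [_ Um]] := U X _ (linear_alg g Hr).
by rewrite -(Um g erefl) -(Um g' (esym E)).
Qed.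

Lemma reflects_map (A : C) (P : presentation A) (Q : algebra T) (r : hom A Q)
    (X : algebra T) (f : hom A X) :
  reflects P r -> linear P f -> exists g : alg_hom Q X, alg_map g ∘ r = f.
Proof. by move=> [_ U] Hf; have [g [Hg _]] := U X f Hf; exists g. Qed.

Lemma reflects_unique (A : C) (P : presentation A) (Q Q' : algebra T)
    (r : hom A Q) (r' : hom A Q') :
  reflects P r -> reflects P r' ->
  exists2 k : alg_hom Q Q', is_iso (k : hom (Q : EM T) Q') & alg_map k ∘ r = r'.
Proof.
move=> Hr Hr'.
have [k Hk] := reflects_map Hr (proj1 Hr').
have [k' Hk'] := reflects_map Hr' (proj1 Hr).
exists k => //; exists k'; split.
  apply: (reflects_inj Hr); rewrite /= -compmA Hk Hk' compm_idl //.
by apply: (reflects_inj Hr'); rewrite /= -compmA Hk' Hk compm_idl.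
Qed.

Lemma alg_iso_is_iso (V W : algebra T) (k : hom (V : EM T) W) :
  is_iso k -> is_iso (alg_map k).
Proof.
move=> [k' [k'k kk']]; exists (alg_map k').
by split; [exact: (congr1 (@alg_map _ _ _ _) k'k)
          | exact: (congr1 (@alg_map _ _ _ _) kk')].
Qed.

Lemma reflects_eta (A : C) (P : presentation A) :
  (forall (X : algebra T) (f : hom A X), linear P f) ->
  reflects (Q := free_alg T A) P (eta T A).
Proof.
move=> HP; split=> [|X f Hf]; first exact: HP.
have Hg : (act X ∘ fmap T f) ∘ mu T A = act X ∘ fmap T (act X ∘ fmap T f).
  by rewrite -compmA -mu_nat fmap_comp !compmA act_mu.
exists (@AlgHom _ _ (free_alg T A) X _ Hg); split => /=.
  by rewrite -compmA -eta_nat compmA act_eta compm_idl.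
move=> g Hgf; apply: alg_hom_inj => /=.
rewrite -Hgf fmap_comp compmA -(alg_mapP g) /= -compmA mu_eta_r.
by rewrite compm_idr.
Qed.

Lemma reflects_id (V : algebra T) : reflects (alg_pres V) (idm V).
Proof.
split=> [|X f Hf]; first exact: (linear_alg_hom (alg_id V)).
have Hg : f ∘ act V = act X ∘ fmap T f by rewrite -Hf /= compm_idr.
exists (AlgHom Hg); split => /=; first by rewrite compm_idr.
by move=> g; rewrite compm_idr => Hgf; apply: alg_hom_inj.
Qed.

(** Linearity of [h] passes to [h ∘ g], for [g] inverse to [f], because the equation may be tested
    after the epimorphism [f']. *)
Lemma reflects_iso (A B : C) (P : presentation A) (P' : presentation B)
    (Q : algebra T) (f : hom A B) (r : hom B Q) (f' : hom (src P) (src P')) :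
  is_iso f -> epi f' -> fmap T f ∘ pl P = pl P' ∘ f' ->
  f ∘ pa P = pa P' ∘ f' -> reflects P' r -> reflects P (r ∘ f).
Proof.
move=> If Ef' Hl Ha Hr; split.
  by apply: linear_comp (proj1 Hr); exists f'.
move=> X h Hh; have Ef := is_iso_epi If.
have [g [gf fg]] := If.
have Hhg : linear P' (h ∘ g).
  apply: Ef'; rewrite /linear -!compmA -Hl -Ha fmap_comp -!compmA.
  rewrite (fmap2 g f) (compm2 _ gf) gf fmap_id !compm_idl.
  by rewrite compmA.
have [m [Hm Um]] := proj2 Hr X _ Hhg; exists m; split.
  by rewrite compmA Hm -compmA gf compm_idr.
by move=> n Hn; apply: Um; apply: Ef; rewrite -!compmA gf compm_idr.
Qed.

(** The canonical presentation of [Q] is transported along [r], keeping [T Q] as source. Thus the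
    invertible maps that serve comonoidal tensor products count as reflections too. *)
Lemma reflects_of_iso (A : C) (Q : algebra T) (r : hom A Q) :
  is_iso r -> exists P : presentation A, reflects P r.
Proof.
move=> Ir; have [g [gr rg]] := Ir.
have H1 : g ∘ act Q ∘ (eta T Q ∘ r) = idm A.
  by rewrite -compmA (compm2 _ (act_eta Q)) compm_idl.
have H2 : fmap T g ∘ (eta T Q ∘ r) = eta T A.
  by rewrite compmA -eta_nat -compmA gr compm_idr.
pose P := Presentation H1 H2; exists P.
rewrite -(compm_idl r).
apply: (@reflects_iso A Q P (alg_pres Q) Q r (idm Q) (idm _)) => //=.
- exact: (is_iso_epi (is_iso_id _)).
- by rewrite -fmap_comp rg fmap_id compm_idl.
- by rewrite compm_idr compmA rg compm_idl.
- exact: reflects_id.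
Qed.

(** * Existence of reflections by reflexive coequalizers *)

Section Reflections.
Context (hC : has_reflexive_coequalizers C).
Context (hT : preserves_reflexive_coequalizers T).
Context (A : C) (P : presentation A).

Lemma presentation_reflexive :
  reflexive_pair (mu T A ∘ fmap T (pl P)) (fmap T (pa P)).
Proof.
exists (fmap T (ps P)); split.
  by rewrite -compmA -fmap_comp pl_s mu_eta_r.
by rewrite -fmap_comp pa_s fmap_id.
Qed.

(** The coequalizer [q] is formed in C. As T preserves it, [q ∘ mu] descends along [T q] to an
    action; the algebra laws follow by cancelling [q] and [T (T q)]. The reflection map is
    [q ∘ eta]. *)
Lemma presentation_coequalizer : exists (Q : algebra T) (r : hom A Q),
  reflects P r /\
  is_coequalizer (mu T A ∘ fmap T (pl P)) (fmap T (pa P)) (act Q ∘ fmap T r).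
Proof.
have Rp := presentation_reflexive.
have [Q [q Hq]] := hC Rp.
have HTq := hT Rp Hq; have [Eq Uq] := Hq.
have HTTq := hT (reflexive_pair_fmap T Rp) HTq.
have epq := coequalizer_epi Hq.
have epTq := coequalizer_epi HTq.
have Hqm : q ∘ mu T A ∘ fmap T (mu T A ∘ fmap T (pl P)) =
           q ∘ mu T A ∘ fmap T (fmap T (pa P)).
  rewrite -!compmA mu_nat [RHS]compmA -Eq !fmap_comp -!compmA.
  by rewrite (compm2 _ (mu_assoc T A)) -!compmA mu_nat.
have [a [Ha _]] := proj2 HTq _ _ Hqm.
have H1 : a ∘ mu T Q = a ∘ fmap T a.
  apply: (coequalizer_epi HTTq); rewrite -!compmA -fmap_comp Ha mu_nat fmap_comp.
  by rewrite (compm2 _ Ha) (compm2 _ Ha) -!compmA mu_assoc.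
have H2 : a ∘ eta T Q = idm Q.
  apply: epq; rewrite -compmA eta_nat (compm2 _ Ha) -compmA mu_eta_l.
  by rewrite compm_idr compm_idl.
pose QA := Algebra H1 H2; exists QA, (q ∘ eta T A).
(* Extending the reflection map to the free algebra on [A] gives back [q], the coequalizer
   claimed. *)
have qE : act QA ∘ fmap T (q ∘ eta T A) = q.
  by rewrite fmap_comp compmA /= Ha -compmA mu_eta_r compm_idr.
rewrite qE; split=> //; split.
  rewrite /linear qE -compmA eta_nat compmA -Eq -!compmA -eta_nat.
  by rewrite (compm2 _ (mu_eta_l T A)) compm_idl.
move=> X f Hf.
have Hxf : act X ∘ fmap T f ∘ (mu T A ∘ fmap T (pl P)) =
           act X ∘ fmap T f ∘ fmap T (pa P).
  rewrite -!compmA -(fmap_comp T f) -Hf (compm2 _ (esym (mu_nat T f))).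
  by rewrite -!compmA (compm2 _ (act_mu X)) !fmap_comp -!compmA.
have [g [Hg Ug]] := Uq _ _ Hxf.
have Hga : g ∘ act QA = act X ∘ fmap T g.
  apply: epTq; rewrite /= -!compmA Ha -fmap_comp Hg fmap_comp.
  rewrite (compm2 _ Hg) -!compmA -mu_nat.
  by rewrite (compm2 _ (act_mu X)) -!compmA.
exists (@AlgHom _ _ QA X g Hga); split => /=.
  by rewrite compmA Hg -compmA -eta_nat compmA act_eta compm_idl.
move=> g' Hg'; apply: alg_hom_inj => /=; apply: Ug.
by rewrite -qE compmA (alg_mapP g') -!compmA -fmap_comp Hg'.
Qed.

(** Reflections are unique up to isomorphism, so the coequalizer found in C for one of them is
    available for all. *)
Lemma reflects_coequalizer (Q : algebra T) (r : hom A Q) :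
  reflects P r ->
  is_coequalizer (mu T A ∘ fmap T (pl P)) (fmap T (pa P)) (act Q ∘ fmap T r).
Proof.
move=> Hr; have [Q' [r' [Hr' Hq']]] := presentation_coequalizer.
have [k Ik Hk] := reflects_unique Hr' Hr.
have -> : act Q ∘ fmap T r = alg_map k ∘ (act Q' ∘ fmap T r').
  by rewrite -Hk fmap_comp !compmA (alg_mapP k).
exact: coequalizer_iso Hq' (alg_iso_is_iso Ik).
Qed.

End Reflections.
End Presentations.

(** * Lax bifunctors and tensor products of presentations *)

Section Bifunctors.
Context (C : category) (T : monad C).

(** The part of a monoidal monad that governs bilinearity, stated without associativity and units:
    exchanging the variables is then immediate, and an argument in the first variable serves for
    both. *)
Record lax_bifunctor := LaxBifunctor {
  bf :> C -> C -> C;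
  bfm : forall A A' B B' : C, hom A A' -> hom B B' -> hom (bf A B) (bf A' B');
  bf_id : forall A B : C, bfm (idm A) (idm B) = idm (bf A B);
  bf_comp : forall (A A' A'' B B' B'' : C)
    (f' : hom A' A'') (f : hom A A') (g' : hom B' B'') (g : hom B B'),
    bfm (f' ∘ f) (g' ∘ g) = bfm f' g' ∘ bfm f g;
  bfl : forall A B : C, hom (bf (T A) (T B)) (T (bf A B));
  bfl_nat : forall (A A' B B' : C) (f : hom A A') (g : hom B B'),
    bfl A' B' ∘ bfm (fmap T f) (fmap T g) = fmap T (bfm f g) ∘ bfl A B;
  bfl_mu : forall A B : C,
    mu T (bf A B) ∘ fmap T (bfl A B) ∘ bfl (T A) (T B) =
    bfl A B ∘ bfm (mu T A) (mu T B);
  bfl_eta : forall A B : C, bfl A B ∘ bfm (eta T A) (eta T B) = eta T (bf A B)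
}.

Definition bf_swap (F : lax_bifunctor) : lax_bifunctor.
Proof.
exists (fun A B => F B A) (fun A A' B B' f g => bfm F g f) (fun A B => bfl F B A).
- by move=> *; exact: bf_id.
- by move=> *; exact: bf_comp.
- by move=> *; exact: bfl_nat.
- by move=> *; exact: bfl_mu.
- by move=> *; exact: bfl_eta.
Defined.

Definition lax_tensor (tens : C -> C -> C) (I : C) (M : monoidal tens I)
    (phi : monoidal_monad M T) : lax_bifunctor :=
  LaxBifunctor (tensm_id M) (tensm_comp M) (lax_nat phi) (lax_mu phi)
    (lax_eta phi).

Definition bf_preserves (F : lax_bifunctor) : Prop :=
  forall (A B Q D : C) (f g : hom A B) (e : hom B Q),
    reflexive_pair f g -> is_coequalizer f g e ->
    is_coequalizer (bfm F f (idm D)) (bfm F g (idm D)) (bfm F e (idm D)).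

Section Tensor.
Context (F : lax_bifunctor).

Definition bf_pres (A B : C) (P : presentation T A) (P' : presentation T B) :
  presentation T (F A B).
Proof.
exists (F (src P) (src P')) (bfl F A B ∘ bfm F (pl P) (pl P'))
  (bfm F (pa P) (pa P')) (bfm F (ps P) (ps P')).
  by rewrite -bf_comp !pa_s bf_id.
by rewrite -compmA -bf_comp !pl_s bfl_eta.
Defined.

Lemma pres_map_bf (A A' B B' : C) (P : presentation T A)
    (P' : presentation T A') (S : presentation T B) (S' : presentation T B')
    (f : hom A A') (g : hom B B') :
  pres_map P P' f -> pres_map S S' g ->
  pres_map (bf_pres P S) (bf_pres P' S') (bfm F f g).
Proof.
move=> [f' [fl fa]] [g' [gl ga]]; exists (bfm F f' g'); split=> /=.
  by rewrite compmA -bfl_nat -!compmA -!bf_comp fl gl.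
by rewrite -!bf_comp fa ga.
Qed.

Section Extension.
Context (hC : has_reflexive_coequalizers C).
Context (hT : preserves_reflexive_coequalizers T).
Context (hF : bf_preserves F).
Context (A B : C) (P : presentation T A) (S : presentation T B).
Context (Q : algebra T) (r : hom A Q) (Hr : reflects P r).

Let Rp := presentation_reflexive P.
Let Hq := reflects_coequalizer hC hT Hr.

(** Linearity determines an extension on [F (T A) B] by its values on [F A B], and the image of the
    coequalizer [T A -> Q] under [F(-, B)] is epi. *)
Lemma linear_extension_inj (X : algebra T) (g g' : hom (F Q B) X) :
  linear (bf_pres (alg_pres Q) S) g -> linear (bf_pres (alg_pres Q) S) g' ->
  g ∘ bfm F r (idm B) = g' ∘ bfm F r (idm B) -> g = g'.
Proof.
have E (h : hom (F Q B) X) : linear (bf_pres (alg_pres Q) S) h ->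
    h ∘ bfm F (act Q ∘ fmap T r) (idm B) =
    act X ∘ fmap T (h ∘ bfm F r (idm B)) ∘ bfl F A B
      ∘ bfm F (idm (T A)) (eta T B).
  move=> Hh.
  (* Writing the identity of [B] as [pa S ∘ ps S] makes the linearity of [h] applicable. *)
  have -> : bfm F (act Q ∘ fmap T r) (idm B)
          = bfm F (act Q) (pa S) ∘ bfm F (fmap T r) (ps S).
    by rewrite -bf_comp pa_s.
  rewrite compmA -Hh /= fmap_comp -!compmA; congr (_ ∘ (_ ∘ _)).
  rewrite (compm2 _ (esym (bfl_nat F _ _))) -!compmA -!bf_comp.
  by rewrite compm_idl compm_idr fmap_id compm_idl pl_s.
move=> Hg Hg' H; apply: (coequalizer_epi (hF B Rp Hq)).
by rewrite (E _ Hg) (E _ Hg') H.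
Qed.

(* The extension is first defined on F (TA) B, as the map induced by f on the
   free algebra in the first variable, and then descended along the coequalizer
   TA -> Q, which F(-, B) and F(T-, src S) preserve. *)
Lemma linear_extension (X : algebra T) (f : hom (F A B) X) :
  linear (bf_pres P S) f ->
  exists2 g : hom (F Q B) X,
    linear (bf_pres (alg_pres Q) S) g & g ∘ bfm F r (idm B) = f.
Proof.
rewrite /linear /= => Hf.
pose h := act X ∘ fmap T f ∘ bfl F A B ∘ bfm F (idm (T A)) (eta T B).
have xTf : act X ∘ fmap T (act X ∘ fmap T f) = act X ∘ fmap T f ∘ mu T (F A B).
  by rewrite fmap_comp -[RHS]compmA -mu_nat !compmA act_mu.
(* The left side is brought, by naturality and [bfl_mu], to a form containing the linearity equation
   of [f], with [ps S] in the second variable. *)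
have Hh : h ∘ bfm F (mu T A ∘ fmap T (pl P)) (idm B) =
          h ∘ bfm F (fmap T (pa P)) (idm B).
  have -> : h ∘ bfm F (mu T A ∘ fmap T (pl P)) (idm B) =
      act X ∘ fmap T (act X ∘ fmap T f ∘ (bfl F A B ∘ bfm F (pl P) (pl S)))
        ∘ bfl F _ _ ∘ bfm F (idm _) (fmap T (ps S) ∘ eta T B).
    rewrite (fmap_comp T (act X ∘ fmap T f)) [in RHS]compmA xTf.
    rewrite (fmap_comp T (bfl F A B)) -!compmA.
    rewrite (compm2 _ (esym (bfl_nat F _ _))) -!compmA.
    rewrite (compm3 _ (bfl_mu F _ _)) /h -!compmA -!bf_comp.
    congr (_ ∘ (_ ∘ (_ ∘ bfm F _ _))); first by rewrite compm_idl compm_idr.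
    rewrite compm_idr fmap2 pl_s.
    by rewrite compmA mu_eta_r compm_idl.
  rewrite Hf fmap_comp -!compmA (compm2 _ (esym (bfl_nat F _ _))) -!compmA.
  by rewrite -!bf_comp fmap2 pa_s fmap_id !compm_idl !compm_idr.
have [g [Hg _]] := proj2 (hF B Rp Hq) _ _ Hh.
have gr : g ∘ bfm F r (idm B) = f.
  have -> : bfm F r (idm B) =
      bfm F (act Q ∘ fmap T r) (idm B) ∘ bfm F (eta T A) (idm B).
    by rewrite -bf_comp -compmA -eta_nat (compm2 _ (act_eta Q)) !compm_idl.
  rewrite compmA Hg /h -!compmA -bf_comp compm_idl compm_idr bfl_eta -eta_nat.
  by rewrite compmA act_eta compm_idl.
exists g => //.
(* Linearity of [g] is an equation out of [F (T Q) (src S)], hence may be tested on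
   [F (T (T A)) (src S)]. *)
have epTq := coequalizer_epi (hF (src S) (reflexive_pair_fmap T Rp) (hT Rp Hq)).
apply: epTq; rewrite /linear /= -!compmA -!bf_comp compm_idl !compm_idr.
have -> : bfl F Q B ∘ bfm F (fmap T (act Q ∘ fmap T r)) (pl S) =
    fmap T (bfm F (act Q ∘ fmap T r) (idm B)) ∘ bfl F _ _
      ∘ bfm F (idm _) (pl S).
  by rewrite -bfl_nat fmap_id -compmA -bf_comp compm_idl compm_idr.
rewrite -!compmA (fmap2 g) Hg.
have -> : bfm F (act Q ∘ fmap T (act Q ∘ fmap T r)) (pa S) =
    bfm F (act Q ∘ fmap T r) (idm B) ∘ bfm F (mu T A) (pa S).
  rewrite -bf_comp compm_idl -compmA -mu_nat fmap_comp.
  by rewrite !compmA act_mu.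
rewrite (compm2 _ Hg).
have hE : act X ∘ fmap T h = act X ∘ fmap T f ∘
    (mu T _ ∘ fmap T (bfl F A B ∘ bfm F (idm (T A)) (eta T B))).
  rewrite /h -(compmA (act X ∘ fmap T f)) (fmap_comp T (act X ∘ fmap T f)).
  by rewrite compmA xTf -compmA.
(* Linearity in the second variable alone, from that of [f] with [ps P] filling the first. *)
have xl : act X ∘ fmap T f ∘ bfl F A B ∘ bfm F (idm (T A)) (eta T B ∘ pa S) =
          act X ∘ fmap T f ∘ bfl F A B ∘ bfm F (idm (T A)) (pl S).
  have -> : bfm F (idm (T A)) (eta T B ∘ pa S) =
      bfm F (fmap T (pa P)) (fmap T (pa S)) ∘ bfm F (fmap T (ps P)) (eta T _).
    by rewrite -bf_comp -fmap_comp pa_s fmap_id eta_nat.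
  rewrite compmA -(compmA _ (bfl F A B)) bfl_nat -!compmA.
  rewrite (fmap2 f) -Hf fmap_comp -!compmA.
  have -> : fmap T (bfl F A B ∘ bfm F (pl P) (pl S)) ∘
      (bfl F _ _ ∘ bfm F (fmap T (ps P)) (eta T (src S))) =
      fmap T (bfl F A B) ∘ (bfl F _ _ ∘ bfm F (fmap T (eta T A)) (eta T _ ∘ pl S)).
    rewrite fmap_comp -!compmA (compm2 _ (esym (bfl_nat F _ _))) -!compmA.
    by rewrite -bf_comp -(fmap_comp T (pl P)) pl_s eta_nat.
  rewrite (compmA (act X)) xTf -!compmA (compm3 _ (bfl_mu F _ _)) -!compmA.
  by rewrite -bf_comp mu_eta_r (compm2 _ (mu_eta_l T B)) compm_idl.
have -> : h ∘ bfm F (mu T A) (pa S) =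
    act X ∘ fmap T f ∘ bfl F A B ∘ bfm F (mu T A) (pl S).
  rewrite /h -!compmA -bf_comp compm_idl.
  have -> : bfm F (mu T A) (eta T B ∘ pa S) =
      bfm F (idm (T A)) (eta T B ∘ pa S) ∘ bfm F (mu T A) (idm _).
    by rewrite -bf_comp compm_idl compm_idr.
  by rewrite !compmA xl -!compmA -bf_comp compm_idl compm_idr.
rewrite (compmA (act X)) hE.
rewrite (fmap_comp T (bfl F A B)) -!compmA.
rewrite (compm2 _ (esym (bfl_nat F _ _))) -!compmA (compm3 _ (bfl_mu F _ _)).
rewrite -!compmA -!bf_comp fmap_id !compm_idr.
by rewrite (compm2 _ (mu_eta_r T B)) compm_idl.
Qed.

End Extension.
End Tensor.

(** One variable is extended at a time: along [r], then along [r'] by means of [bf_swap F]. The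
    result is linear on [F Q Q'] and factors through [u]; uniqueness retraces the two extensions. *)
Lemma reflects_bf (hC : has_reflexive_coequalizers C)
    (hT : preserves_reflexive_coequalizers T) (F : lax_bifunctor)
    (hl : bf_preserves F) (hr : bf_preserves (bf_swap F)) (A B : C)
    (P : presentation T A) (S : presentation T B) (Q Q' Z : algebra T)
    (r : hom A Q) (r' : hom B Q') (u : hom (F Q Q') Z) :
  reflects P r -> reflects S r' ->
  reflects (bf_pres F (alg_pres Q) (alg_pres Q')) u ->
  reflects (bf_pres F P S) (u ∘ bfm F r r').
Proof.
move=> Hr Hr' Hu.
have mr : pres_map P (alg_pres Q) r := pres_map_linear (proj1 Hr).
have mr' : pres_map S (alg_pres Q') r' := pres_map_linear (proj1 Hr').
have rE : bfm F r r' = bfm F (idm Q) r' ∘ bfm F r (idm B).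
  by rewrite -bf_comp compm_idl compm_idr.
have mir : pres_map (bf_pres F (alg_pres Q) S)
    (bf_pres F (alg_pres Q) (alg_pres Q')) (bfm F (idm Q) r').
  exact: pres_map_bf (pres_map_id _) mr'.
split; first exact: linear_comp (pres_map_bf F mr mr') (proj1 Hu).
move=> X f Hf.
have [g Hg gf] := linear_extension hC hT hl Hr Hf.
have [k Hk kg] := @linear_extension (bf_swap F) hC hT hr _ _ S (alg_pres Q)
  _ _ Hr' X g Hg.
have [m [Hm Um]] := proj2 Hu X k Hk.
exists m; split; first by rewrite rE compmA Hm compmA -gf -kg.
move=> n Hn; apply: Um.
have Hnu := linear_alg n (proj1 Hu).
apply: (@linear_extension_inj (bf_swap F) hC hT hr _ _ S (alg_pres Q)
  _ _ Hr' X _ _ Hnu Hk).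
rewrite kg; apply: (linear_extension_inj hC hT hl Hr _ Hg).
  exact: linear_comp mir Hnu.
by rewrite gf -Hn rE -!compmA.
Qed.

End Bifunctors.

(** * Transfer of the n-monoidal axioms along restriction maps *)

Section Transfer.
Context (C : category) (T : monad C) (n : nat) (X : Type) (pos : X -> 'I_n).
Context (tens : X -> C -> C -> C) (I : X -> C) (N : n_monoidal pos tens I).
Context (tensT : X -> EM T -> EM T -> EM T) (IT : X -> EM T).

(** [g] restricts to [f]. Such squares paste under composition and tensor products, which is what
    carries equations from C to C^T. *)
Definition lifts (A B : C) (V W : EM T) (r : hom A (carrier V))
    (r' : hom B (carrier W)) (f : hom A B) (g : hom V W) : Prop :=
  alg_map g ∘ r = r' ∘ f.

Context (ut : forall (s : X) (V W : EM T),
  hom (tens s (carrier V) (carrier W)) (carrier (tensT s V W))).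
Context (uI : forall s : X, hom (I s) (carrier (IT s))).

Definition rt (s : X) (A B : C) (V W : EM T) (r : hom A (carrier V))
    (r' : hom B (carrier W)) : hom (tens s A B) (carrier (tensT s V W)) :=
  ut s V W ∘ (r ⊗[mon N s] r').

(* cls s r: the map r : A -> V exhibits the algebra V as the reflection of A
   along the first tensor products (r is universal among suitable maps to
   algebras), or, for the labels whose tensor product is computed in C, r is
   invertible.  Every axiom of C^T is checked after precomposition with such an
   r, where it becomes the same axiom of C. *)
Context (cls : X -> forall (A : C) (V : EM T), hom A (carrier V) -> Prop).
Context (cls_inj : forall (s : X) (A : C) (V : EM T) (r : hom A (carrier V)),
  cls s r -> forall (W : EM T) (g g' : hom V W),
  alg_map g ∘ r = alg_map g' ∘ r -> g = g').
Context (cls_id : forall (s : X) (V : EM T), cls s (idm (carrier V))).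
Context (cls_unit : forall s : X, cls s (uI s)).
Context (cls_tens : forall (s : X) (A B : C) (V W : EM T)
  (r : hom A (carrier V)) (r' : hom B (carrier W)),
  cls s r -> cls s r' -> cls s (rt s r r')).
(** Axioms that mix tensor products are tested on sources with the earlier label outside, so
    restriction maps for a later label must serve as factors for an earlier one. *)
Context (cls_lt : forall (s t : X) (A : C) (V : EM T) (r : hom A (carrier V)),
  pos s < pos t -> cls t r -> cls s r).

Notation one V := (idm (carrier V)).

(** Each structure morphism comes with the morphism of C to which it restricts; the axioms use
    nothing more, apart from the invertibility of associators and unitors. *)
Context (tensmT : forall (s : X) (V V' W W' : EM T) (f : hom V V') (g : hom W W'),
  {h : hom (tensT s V W) (tensT s V' W')
  | lifts (ut s V W) (ut s V' W') (alg_map f ⊗[mon N s] alg_map g) h}).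
Context (assocT : forall (s : X) (V W Z : EM T),
  {h : hom (tensT s (tensT s V W) Z) (tensT s V (tensT s W Z))
  | is_iso h /\
    lifts (rt s (ut s V W) (one Z)) (rt s (one V) (ut s W Z))
      (assoc (mon N s) V W Z) h}).
Context (lunitT : forall (s : X) (V : EM T),
  {h : hom (tensT s (IT s) V) V
  | is_iso h /\ lifts (rt s (uI s) (one V)) (one V) (lunit (mon N s) V) h}).
Context (runitT : forall (s : X) (V : EM T),
  {h : hom (tensT s V (IT s)) V
  | is_iso h /\ lifts (rt s (one V) (uI s)) (one V) (runit (mon N s) V) h}).
Context (zetaT : forall (s t : X) (st : pos s < pos t) (A B V W : EM T),
  {h : hom (tensT s (tensT t A B) (tensT t V W))
           (tensT t (tensT s A V) (tensT s B W))
  | lifts (rt s (ut t A B) (ut t V W)) (rt t (ut s A V) (ut s B W))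
      (zeta (duo N st) A B V W) h}).
Context (deltaT : forall (s t : X) (st : pos s < pos t),
  {h : hom (IT s) (tensT t (IT s) (IT s))
  | lifts (uI s) (rt t (uI s) (uI s)) (delta (duo N st)) h}).
Context (thetaT : forall (s t : X) (st : pos s < pos t),
  {h : hom (tensT s (IT t) (IT t)) (IT t)
  | lifts (rt s (uI t) (uI t)) (uI t) (theta (duo N st)) h}).
Context (nuT : forall (s t : X) (st : pos s < pos t),
  {h : hom (IT s) (IT t) | lifts (uI s) (uI t) (nu (duo N st)) h}).

Lemma lifts_eq (s : X) (A : C) (V : EM T) (r : hom A (carrier V)) (B : C)
    (W : EM T) (r' : hom B (carrier W)) (f f' : hom A B) (g g' : hom V W) :
  cls s r -> lifts r r' f g -> lifts r r' f' g' -> f = f' -> g = g'.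
Proof. by move=> Hr Hg Hg' E; apply: (cls_inj Hr); rewrite Hg Hg' E. Qed.

Lemma lifts_id (A : C) (V : EM T) (r : hom A (carrier V)) :
  lifts r r (idm A) (idm V).
Proof. by rewrite /lifts /= compm_idl compm_idr. Qed.

Lemma lifts_hom (V W : EM T) (g : hom V W) :
  lifts (one V) (one W) (alg_map g) g.
Proof. by rewrite /lifts compm_idl compm_idr. Qed.

Lemma lifts_comp (A B D : C) (V W Z : EM T) (r : hom A (carrier V))
    (r' : hom B (carrier W)) (r'' : hom D (carrier Z)) (f : hom A B)
    (f' : hom B D) (g : hom V W) (g' : hom W Z) :
  lifts r r' f g -> lifts r' r'' f' g' -> lifts r r'' (f' ∘ f) (g' ∘ g).
Proof. by rewrite /lifts /= => Hg Hg'; rewrite -compmA Hg compmA Hg' compmA. Qed.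

Lemma lifts_tens (s : X) (A A' B B' : C) (V V' W W' : EM T)
    (r : hom A (carrier V)) (r' : hom A' (carrier V')) (q : hom B (carrier W))
    (q' : hom B' (carrier W')) (f : hom A A') (k : hom B B') (g : hom V V')
    (h : hom W W') :
  lifts r r' f g -> lifts q q' k h ->
  lifts (rt s r q) (rt s r' q') (f ⊗[mon N s] k) (sval (tensmT s g h)).
Proof.
move=> Hg Hh; rewrite /lifts /rt compmA (svalP (tensmT s g h)) -!compmA.
by rewrite -!tensm_comp Hg Hh.
Qed.

(** The hypothesis has identities as restriction maps of the three factors; naturality in C gives
    arbitrary ones. The unitors and [zeta] are treated alike. *)
Lemma lifts_assoc (s : X) (A B D : C) (V W Z : EM T)
    (r : hom A (carrier V)) (r' : hom B (carrier W)) (r'' : hom D (carrier Z)) :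
  lifts (rt s (rt s r r') r'') (rt s r (rt s r' r''))
    (assoc (mon N s) A B D) (sval (assocT s V W Z)).
Proof.
have [_ E] := svalP (assocT s V W Z).
have E1 : rt s (rt s r r') r'' =
    rt s (ut s V W) (one Z) ∘ ((r ⊗[mon N s] r') ⊗[mon N s] r'').
  by rewrite /rt -compmA -tensm_comp compm_idl.
have E2 : rt s r (rt s r' r'') =
    rt s (one V) (ut s W Z) ∘ (r ⊗[mon N s] (r' ⊗[mon N s] r'')).
  by rewrite /rt -compmA -tensm_comp compm_idl.
by rewrite /lifts E1 E2 compmA E -!compmA assoc_nat.
Qed.

Lemma lifts_lunit (s : X) (A : C) (V : EM T) (r : hom A (carrier V)) :
  lifts (rt s (uI s) r) r (lunit (mon N s) A) (sval (lunitT s V)).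
Proof.
have [_ E] := svalP (lunitT s V).
have E1 : rt s (uI s) r = rt s (uI s) (one V) ∘ (idm (I s) ⊗[mon N s] r).
  by rewrite /rt -compmA -tensm_comp compm_idl compm_idr.
by rewrite /lifts E1 compmA E compm_idl lunit_nat.
Qed.

Lemma lifts_runit (s : X) (A : C) (V : EM T) (r : hom A (carrier V)) :
  lifts (rt s r (uI s)) r (runit (mon N s) A) (sval (runitT s V)).
Proof.
have [_ E] := svalP (runitT s V).
have E1 : rt s r (uI s) = rt s (one V) (uI s) ∘ (r ⊗[mon N s] idm (I s)).
  by rewrite /rt -compmA -tensm_comp compm_idl compm_idr.
by rewrite /lifts E1 compmA E compm_idl runit_nat.
Qed.

Lemma lifts_zeta (s t : X) (st : pos s < pos t) (A B D E : C)
    (V V' W W' : EM T) (a : hom A (carrier V)) (b : hom B (carrier V'))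
    (d : hom D (carrier W)) (e : hom E (carrier W')) :
  lifts (rt s (rt t a b) (rt t d e)) (rt t (rt s a d) (rt s b e))
    (zeta (duo N st) A B D E) (sval (zetaT st V V' W W')).
Proof.
have H := svalP (zetaT st V V' W W').
have E1 : rt s (rt t a b) (rt t d e) = rt s (ut t V V') (ut t W W') ∘
    ((a ⊗[mon N t] b) ⊗[mon N s] (d ⊗[mon N t] e)).
  by rewrite /rt -compmA -tensm_comp.
have E2 : rt t (rt s a d) (rt s b e) = rt t (ut s V W) (ut s V' W') ∘
    ((a ⊗[mon N s] d) ⊗[mon N t] (b ⊗[mon N s] e)).
  by rewrite /rt -compmA -tensm_comp.
by rewrite /lifts E1 E2 compmA H -!compmA zeta_nat.
Qed.

Lemma lifts_delta (s t : X) (st : pos s < pos t) :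
  lifts (uI s) (rt t (uI s) (uI s)) (delta (duo N st)) (sval (deltaT st)).
Proof. exact: svalP. Qed.

Lemma lifts_theta (s t : X) (st : pos s < pos t) :
  lifts (rt s (uI t) (uI t)) (uI t) (theta (duo N st)) (sval (thetaT st)).
Proof. exact: svalP. Qed.

Lemma lifts_nu (s t : X) (st : pos s < pos t) :
  lifts (uI s) (uI t) (nu (duo N st)) (sval (nuT st)).
Proof. exact: svalP. Qed.

(** Reads a restriction off the syntax of a morphism of C^T, leaving the morphism of C to
    unification. [lifts_hom] comes last, for morphisms that are variables. *)
Ltac lift := first
  [ eapply lifts_comp; [lift | lift]
  | eapply lifts_id
  | eapply lifts_tens; [lift | lift]
  | eapply lifts_assoc | eapply lifts_lunit | eapply lifts_runit
  | eapply lifts_zeta | eapply lifts_delta | eapply lifts_theta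
  | eapply lifts_nu | eapply lifts_hom ].

Ltac in_cls := first
  [ apply: cls_id | apply: cls_unit | apply: cls_tens; in_cls
  | match goal with st : _ |- _ => eapply (cls_lt st); in_cls end ].

(** [r] copies the bracketing of the common source of both sides, with identities at algebras and
    [uI] at units; what remains is the axiom in C. *)
Ltac by_lifting r := eapply (lifts_eq (r := r)); [in_cls | lift | lift | ].

Definition EM_monoidal (s : X) : monoidal (C := EM T) (tensT s) (IT s).
Proof.
refine (@Monoidal (EM T) (tensT s) (IT s)
  (fun V V' W W' f g => sval (tensmT s f g)) (fun V W Z => sval (assocT s V W Z))
  (fun V => sval (lunitT s V)) (fun V => sval (runitT s V)) _ _ _ _ _ _ _ _ _ _).
- move=> A B; by_lifting (rt s (one A) (one B)); exact: tensm_id.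
- move=> A A' A'' B B' B'' f' f g' g.
  by_lifting (rt s (one A) (one B)); exact: tensm_comp.
- move=> A A' B B' D D' f g h.
  by_lifting (rt s (rt s (one A) (one B)) (one D)); exact: assoc_nat.
- by move=> A A' f; by_lifting (rt s (uI s) (one A)); exact: lunit_nat.
- by move=> A A' f; by_lifting (rt s (one A) (uI s)); exact: runit_nat.
- by move=> A B D; case: (svalP (assocT s A B D)).
- by move=> A; case: (svalP (lunitT s A)).
- by move=> A; case: (svalP (runitT s A)).
- move=> A B D E.
  by_lifting (rt s (rt s (rt s (one A) (one B)) (one D)) (one E)).
  exact: pentagon.
- move=> A B; by_lifting (rt s (rt s (one A) (uI s)) (one B)); exact: triangle.
Defined.

Definition EM_duoidal (s t : X) (st : pos s < pos t) :
  duoidal (EM_monoidal s) (EM_monoidal t).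
Proof.
refine (@Duoidal (EM T) (tensT s) (IT s) (EM_monoidal s) (tensT t) (IT t)
  (EM_monoidal t) (fun A B V W => sval (zetaT st A B V W)) (sval (deltaT st))
  (sval (thetaT st)) (sval (nuT st)) _ _ _ _ _ _ _ _ _ _ _ _ _).
- move=> A A' B B' D D' E E' a b d e.
  by_lifting (rt s (rt t (one A) (one B)) (rt t (one D) (one E))).
  exact: zeta_nat.
- move=> A B D V W Z.
  by_lifting (rt s (rt s (rt t (one A) (one V)) (rt t (one B) (one W)))
    (rt t (one D) (one Z))).
  exact: zeta_assoc_dia.
- move=> A B D V W Z.
  by_lifting (rt s (rt t (rt t (one A) (one B)) (one D))
    (rt t (rt t (one V) (one W)) (one Z))).
  exact: zeta_assoc_star.
- move=> A B; by_lifting (rt s (uI s) (rt t (one A) (one B))).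
  exact: zeta_delta_l.
- move=> A B; by_lifting (rt s (rt t (one A) (one B)) (uI s)).
  exact: zeta_delta_r.
- move=> A B.
  by_lifting (rt s (rt t (uI t) (one A)) (rt t (uI t) (one B))).
  exact: zeta_theta_l.
- move=> A B.
  by_lifting (rt s (rt t (one A) (uI t)) (rt t (one B) (uI t))).
  exact: zeta_theta_r.
- by_lifting (rt s (rt s (uI t) (uI t)) (uI t)); exact: theta_assoc.
- by_lifting (rt s (uI s) (uI t)); exact: theta_nu_l.
- by_lifting (rt s (uI t) (uI s)); exact: theta_nu_r.
- by_lifting (uI s); exact: delta_coassoc.
- by_lifting (uI s); exact: delta_nu_l.
- by_lifting (uI s); exact: delta_nu_r.
Defined.

Lemma EM_trimonoidal (i j k : X) (ij : pos i < pos j) (ik : pos i < pos k)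
    (jk : pos j < pos k) :
  trimonoidal (EM_duoidal ij) (EM_duoidal ik) (EM_duoidal jk).
Proof.
have H := tri N ij ik jk; split.
- move=> A1 A2 B1 B2 D1 D2 E1 E2.
  by_lifting (rt i
    (rt j (rt k (one A1) (one B1)) (rt k (one A2) (one B2)))
    (rt j (rt k (one D1) (one E1)) (rt k (one D2) (one E2)))).
  exact: (tri_zeta H).
- by_lifting (uI i); exact: (tri_zeta_delta H).
- by_lifting (rt i (uI j) (uI j)); exact: (tri_theta_delta H).
- by_lifting (rt i (rt j (uI k) (uI k)) (rt j (uI k) (uI k))).
  exact: (tri_theta_zeta H).
- by_lifting (uI i); exact: (tri_nu_delta H).
- by_lifting (uI i); exact: (tri_theta_nu_delta H).
- by_lifting (rt i (uI j) (uI j)); exact: (tri_nu_theta H).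
- by_lifting (uI i); exact: (tri_nu_nu H).
Qed.

Definition EM_n_monoidal : n_monoidal (C := EM T) pos tensT IT :=
  @NMonoidal n X pos (EM T) tensT IT (pos_bij N) EM_monoidal EM_duoidal
    EM_trimonoidal.

End Transfer.

(** * Tensor products of algebras over a comonoidal monad *)

Section ComonoidalLift.
Context (C : category) (tens : C -> C -> C) (I : C) (M : monoidal tens I).
Context (T : monad C) (psi : comonoidal_monad M T).

Lemma cotens_tensm (V V' W W' : algebra T) (f : alg_hom V V')
    (g : alg_hom W W') :
  (alg_map f ⊗[M] alg_map g) ∘ act (cotens_alg psi V W) =
  act (cotens_alg psi V' W') ∘ fmap T (alg_map f ⊗[M] alg_map g).
Proof.
rewrite /= -[RHS]compmA colax_nat !compmA -!tensm_comp.
by rewrite (alg_mapP f) (alg_mapP g).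
Qed.

Lemma cotens_assoc (V W Z : algebra T) :
  assoc M V W Z ∘ act (cotens_alg psi (cotens_alg psi V W) Z) =
  act (cotens_alg psi V (cotens_alg psi W Z)) ∘ fmap T (assoc M V W Z).
Proof.
have E1 : ((act V ⊗[M] act W) ∘ colax psi V W) ⊗[M] act Z =
    ((act V ⊗[M] act W) ⊗[M] act Z) ∘ (colax psi V W ⊗[M] idm (T Z)).
  by rewrite -tensm_comp compm_idr.
have E2 : act V ⊗[M] ((act W ⊗[M] act Z) ∘ colax psi W Z) =
    (act V ⊗[M] (act W ⊗[M] act Z)) ∘ (idm (T V) ⊗[M] colax psi W Z).
  by rewrite -tensm_comp compm_idr.
rewrite /= E1 E2 -!compmA (compm2 _ (assoc_nat M _ _ _)) -!compmA.
by congr (_ ∘ _); rewrite !compmA colax_assoc.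
Qed.

Lemma cotens_lunit (V : algebra T) :
  lunit M V ∘ act (cotens_alg psi (counit_alg psi) V) =
  act V ∘ fmap T (lunit M V).
Proof.
have E : colax0 psi ⊗[M] act V =
    (idm I ⊗[M] act V) ∘ (colax0 psi ⊗[M] idm (T V)).
  by rewrite -tensm_comp compm_idl compm_idr.
rewrite /= E -(colax_lunit psi) -!compmA (compm2 _ (lunit_nat M _)) -!compmA.
by [].
Qed.

Lemma cotens_runit (V : algebra T) :
  runit M V ∘ act (cotens_alg psi V (counit_alg psi)) =
  act V ∘ fmap T (runit M V).
Proof.
have E : act V ⊗[M] colax0 psi =
    (act V ⊗[M] idm I) ∘ (idm (T V) ⊗[M] colax0 psi).
  by rewrite -tensm_comp compm_idl compm_idr.
rewrite /= E -(colax_runit psi) -!compmA (compm2 _ (runit_nat M _)) -!compmA.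
by [].
Qed.


(** [colax_mu] says that [colax] is a morphism out of a free algebra. Together with [colax0_alg]
    this yields [delta] and [nu] for a monoidal label followed by a comonoidal one. *)
Definition colax_alg (A B : C) :
  alg_hom (free_alg T (tens A B)) (cotens_alg psi (free_alg T A) (free_alg T B)).
Proof. by exists (colax psi A B); rewrite /= colax_mu. Defined.

Definition colax0_alg : alg_hom (free_alg T I) (counit_alg psi).
Proof. by exists (colax0 psi); rewrite /= colax0_mu. Defined.

End ComonoidalLift.

Definition free_map (C : category) (T : monad C) (A B : C) (f : hom A B) :
  alg_hom (free_alg T A) (free_alg T B).
Proof. by exists (fmap T f); rewrite /= mu_nat. Defined.

(** * Universal bilinear maps as reflections, and the class of restriction maps *)

Section Lifting.
Context (p q : nat) (C : category).
Context (tens : 'I_p + 'I_q -> C -> C -> C) (I : 'I_p + 'I_q -> C).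
Context (N : n_monoidal (@unsplit p q) tens I).
Context (T : monad C) (G : pq_monoidal_monad N T).
Context (hC : has_reflexive_coequalizers C).
Context (hT : preserves_reflexive_coequalizers T).
Context (hl : forall (i : 'I_p) (A : C),
  preserves_reflexive_coequalizers (ltens (mon N (inl i)) A)).
Context (hr : forall (i : 'I_p) (A : C),
  preserves_reflexive_coequalizers (rtens (mon N (inl i)) A)).

Let F (i : 'I_p) : lax_bifunctor T := lax_tensor (gaml G i).

Lemma linear_bilinear (i : 'I_p) (V W Z : algebra T)
    (f : hom (tens (inl i) V W) Z) :
  linear (bf_pres (F i) (alg_pres V) (alg_pres W)) f <-> bilinear (gaml G i) f.
Proof. by rewrite /linear /bilinear /= tensm_id compm_idr. Qed.

Lemma universal_reflects (i : 'I_p) (V W Z : algebra T)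
    (f : hom (tens (inl i) V W) Z) :
  universal_bilinear (gaml G i) f <->
  reflects (bf_pres (F i) (alg_pres V) (alg_pres W)) f.
Proof.
split=> -[Hf U]; split; try exact/linear_bilinear.
  by move=> Y g /linear_bilinear; exact: U.
by move=> Y g /linear_bilinear; exact: U.
Qed.

Lemma universal_bilinear_exists (i : 'I_p) (V W : algebra T) :
  exists (Z : algebra T) (f : hom (tens (inl i) V W) Z),
    universal_bilinear (gaml G i) f.
Proof.
have [Z [f [Hf _]]] := presentation_coequalizer hC hT
  (bf_pres (F i) (alg_pres V) (alg_pres W)).
by exists Z, f; exact/universal_reflects.
Qed.

Lemma unsplit_rl (i : 'I_p) (j : 'I_q) :
  ~~ (@unsplit p q (inr j) < @unsplit p q (inl i)).
Proof. by rewrite -leqNgt /= (leq_trans (ltnW (ltn_ord i))) // leq_addr. Qed.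

Context (tp : 'I_p -> algebra T -> algebra T -> algebra T).
Context (u : forall (i : 'I_p) (V W : algebra T),
  hom (tens (inl i) V W) (tp i V W)).
Context (hu : forall (i : 'I_p) (V W : algebra T),
  universal_bilinear (gaml G i) (u i V W)).

Let tensT : 'I_p + 'I_q -> EM T -> EM T -> EM T := alg_tens G tp.
Let IT : 'I_p + 'I_q -> EM T := alg_unit G.

Definition tens_map (s : 'I_p + 'I_q) :
    forall V W : EM T,
      hom (tens s (carrier V) (carrier W)) (carrier (tensT s V W)) :=
  match s with
  | inl i => u i
  | inr j => fun V W => idm (tens (inr j) (carrier V) (carrier W))
  end.

Definition unit_map (s : 'I_p + 'I_q) : hom (I s) (carrier (IT s)) :=
  match s with
  | inl i => eta T (I (inl i))
  | inr j => idm (I (inr j))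
  end.

(** The presentation is quantified away because it changes with every tensor product, while the
    class has to depend on the map alone. *)
Definition lift_class (s : 'I_p + 'I_q) (A : C) (V : EM T)
    (r : hom A (carrier V)) : Prop :=
  match s with
  | inl _ => exists P : presentation T A, reflects P r
  | inr _ => is_iso r
  end.

Lemma lift_class_inj (s : 'I_p + 'I_q) (A : C) (V : EM T)
    (r : hom A (carrier V)) :
  lift_class s r -> forall (W : EM T) (g g' : hom V W),
  alg_map g ∘ r = alg_map g' ∘ r -> g = g'.
Proof.
case: s => [i [P Hr]|j Hr] W g g' E; first exact: reflects_inj Hr E.
by apply: alg_hom_inj; apply: is_iso_epi E.
Qed.

Lemma lift_class_id (s : 'I_p + 'I_q) (V : EM T) :
  lift_class s (idm (carrier V)).
Proof.
case: s => [i|j]; last exact: is_iso_id.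
by exists (alg_pres V); exact: reflects_id.
Qed.

Lemma reflects_discrete (A : C) :
  reflects (Q := free_alg T A) (discrete_pres T A) (eta T A).
Proof. by apply: reflects_eta => Y f; exact: linear_discrete. Qed.

Lemma lift_class_unit (s : 'I_p + 'I_q) : lift_class s (unit_map s).
Proof.
case: s => [i|j]; last exact: is_iso_id.
by exists (discrete_pres T _); exact: reflects_discrete.
Qed.

Lemma reflects_tens (i : 'I_p) (A B : C) (P : presentation T A)
    (S : presentation T B) (V W : algebra T) (r : hom A V) (r' : hom B W) :
  reflects P r -> reflects S r' ->
  reflects (bf_pres (F i) P S) (u i V W ∘ (r ⊗[mon N (inl i)] r')).
Proof.
move=> Hr Hr'; apply: (reflects_bf hC hT (F := F i)) => //.
- by move=> A' B' Q D f g e; exact: hr.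
- by move=> A' B' Q D f g e; exact: hl.
- exact/universal_reflects.
Qed.

Lemma lift_class_tens (s : 'I_p + 'I_q) (A B : C) (V W : EM T)
    (r : hom A (carrier V)) (r' : hom B (carrier W)) :
  lift_class s r -> lift_class s r' -> lift_class s (rt N tens_map s r r').
Proof.
case: s => [i [P Hr] [S Hr']|j Hr Hr'].
  by exists (bf_pres (F i) P S); exact: reflects_tens.
by rewrite /rt /= compm_idl; apply: is_iso_tensm.
Qed.

(** Only the passage from a comonoidal label to a monoidal one has content: an invertible map is a
    reflection. The order excludes the reverse passage. *)
Lemma lift_class_lt (s t : 'I_p + 'I_q) (A : C) (V : EM T)
    (r : hom A (carrier V)) :
  unsplit s < unsplit t -> lift_class t r -> lift_class s r.
Proof.
case: s t => [i|j] [i'|j'] //= st; first exact: reflects_of_iso.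
by have := unsplit_rl i' j; rewrite st.
Qed.

Lemma alg_hom_iso (V W : EM T) (f : hom V W) : is_iso (alg_map f) -> is_iso f.
Proof.
move=> [g [gf fg]].
have Hg : g ∘ act W = act V ∘ fmap T g.
  have If : is_iso (fmap T (alg_map f)).
    by exists (fmap T g); rewrite -!fmap_comp gf fg !fmap_id.
  apply: (is_iso_epi If); rewrite -!compmA -fmap_comp gf fmap_id compm_idr.
  by rewrite -(alg_mapP f) compmA gf compm_idl.
by exists (AlgHom Hg : hom W V); split; apply: alg_hom_inj.
Qed.

(** * Existence of the structure morphisms of C^T *)

Lemma lift_tensm (s : 'I_p + 'I_q) (V V' W W' : EM T) (f : hom V V')
    (g : hom W W') :
  exists h : hom (tensT s V W) (tensT s V' W'),
    lifts (tens_map s V W) (tens_map s V' W')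
      (alg_map f ⊗[mon N s] alg_map g) h.
Proof.
case: s => [i|j].
  apply: (reflects_map (proj1 (universal_reflects _) (hu i V W))).
  have Hu := proj1 (proj1 (universal_reflects _) (hu i V' W')).
  apply: linear_comp Hu; apply: (pres_map_bf (F i));
    exact: pres_map_linear (linear_alg_hom _).
exists (@AlgHom _ _ (tensT (inr j) V W) (tensT (inr j) V' W') _
  (cotens_tensm _ f g)).
by rewrite /lifts /= compm_idl compm_idr.
Qed.

(** For a monoidal label, the presentations of the two bracketings correspond under the associators
    at [V, W, Z] and at [T V, T W, T Z], by [lax_assoc]; uniqueness of reflections gives the
    isomorphism. *)
Lemma lift_assoc (s : 'I_p + 'I_q) (V W Z : EM T) :
  exists h : hom (tensT s (tensT s V W) Z) (tensT s V (tensT s W Z)),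
    is_iso h /\
    lifts (rt N tens_map s (tens_map s V W) (idm (carrier Z)))
      (rt N tens_map s (idm (carrier V)) (tens_map s W Z))
      (assoc (mon N s) (carrier V) (carrier W) (carrier Z)) h.
Proof.
case: s => [i|j].
  have R1 := reflects_tens i (proj1 (universal_reflects _) (hu i V W))
    (reflects_id Z).
  have R2 := reflects_tens i (reflects_id V)
    (proj1 (universal_reflects _) (hu i W Z)).
  have [|k Ik Hk] := reflects_unique R1
    (r' := u i V (tp i W Z) ∘ (idm (carrier V) ⊗[mon N (inl i)] u i W Z)
           ∘ assoc (mon N (inl i)) V W Z); last by exists k.
  apply: (@reflects_iso C T _ _
    (bf_pres (F i) (bf_pres (F i) (alg_pres V) (alg_pres W)) (alg_pres Z))
    (bf_pres (F i) (alg_pres V) (bf_pres (F i) (alg_pres W) (alg_pres Z)))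
    (tp i V (tp i W Z)) (assoc (mon N (inl i)) V W Z) _
    (assoc (mon N (inl i)) (T V) (T W) (T Z)) _ _ _ _ R2) => /=.
  - exact: assoc_iso.
  - exact: is_iso_epi (assoc_iso _ _ _ _).
  - by rewrite !tensm_id !compm_idr compmA lax_assoc.
  - exact: assoc_nat.
exists (@AlgHom _ _ (tensT (inr j) (tensT (inr j) V W) Z)
  (tensT (inr j) V (tensT (inr j) W Z)) _ (cotens_assoc _ V W Z)).
split; first by apply: alg_hom_iso; exact: assoc_iso.
by rewrite /lifts /rt /= !compm_idl !tensm_id compm_idl compm_idr.
Qed.
(** For a monoidal label the unit is presented discretely; as [lax0] equals [eta], the law
    [lax_lunit] makes the unitor at [T V] the required map of sources. *)
Lemma lift_lunit (s : 'I_p + 'I_q) (V : EM T) :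
  exists h : hom (tensT s (IT s) V) V,
    is_iso h /\
    lifts (rt N tens_map s (unit_map s) (idm (carrier V))) (idm (carrier V))
      (lunit (mon N s) (carrier V)) h.
Proof.
case: s => [i|j].
  have R1 := reflects_tens i (reflects_discrete (I (inl i))) (reflects_id V).
  have [|k Ik Hk] := reflects_unique R1
    (r' := idm (carrier V) ∘ lunit (mon N (inl i)) V); last by exists k.
  apply: (@reflects_iso C T _ _
    (bf_pres (F i) (discrete_pres T (I (inl i))) (alg_pres V)) (alg_pres V)
    V (lunit (mon N (inl i)) V) _ (lunit (mon N (inl i)) (T V))
    _ _ _ _ (reflects_id V)) => /=.
  - exact: lunit_iso.
  - exact: is_iso_epi (lunit_iso _ _).
  - by rewrite compm_idl compmA -(lax0_eta (gaml G i)) lax_lunit.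
  - exact: lunit_nat.
exists (@AlgHom _ _ (tensT (inr j) (IT (inr j)) V) V _ (cotens_lunit _ V)).
split; first by apply: alg_hom_iso; exact: lunit_iso.
by rewrite /lifts /rt /= !compm_idl !tensm_id compm_idr.
Qed.

Lemma lift_runit (s : 'I_p + 'I_q) (V : EM T) :
  exists h : hom (tensT s V (IT s)) V,
    is_iso h /\
    lifts (rt N tens_map s (idm (carrier V)) (unit_map s)) (idm (carrier V))
      (runit (mon N s) (carrier V)) h.
Proof.
case: s => [i|j].
  have R1 := reflects_tens i (reflects_id V) (reflects_discrete (I (inl i))).
  have [|k Ik Hk] := reflects_unique R1
    (r' := idm (carrier V) ∘ runit (mon N (inl i)) V); last by exists k.
  apply: (@reflects_iso C T _ _
    (bf_pres (F i) (alg_pres V) (discrete_pres T (I (inl i)))) (alg_pres V)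
    V (runit (mon N (inl i)) V) _ (runit (mon N (inl i)) (T V))
    _ _ _ _ (reflects_id V)) => /=.
  - exact: runit_iso.
  - exact: is_iso_epi (runit_iso _ _).
  - by rewrite compm_idl compmA -(lax0_eta (gaml G i)) lax_runit.
  - exact: runit_nat.
exists (@AlgHom _ _ (tensT (inr j) V (IT (inr j))) V _ (cotens_runit _ V)).
split; first by apply: alg_hom_iso; exact: runit_iso.
by rewrite /lifts /rt /= !compm_idl !tensm_id compm_idr.
Qed.

Lemma lift_zeta (s t : 'I_p + 'I_q) (st : unsplit s < unsplit t)
    (A B V W : EM T) :
  exists h : hom (tensT s (tensT t A B) (tensT t V W))
                 (tensT t (tensT s A V) (tensT s B W)),
    lifts (rt N tens_map s (tens_map t A B) (tens_map t V W))
      (rt N tens_map t (tens_map s A V) (tens_map s B W))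
      (zeta (duo N st) (carrier A) (carrier B) (carrier V) (carrier W)) h.
Proof.
have Ru i V1 V2 := proj1 (universal_reflects _) (hu i V1 V2).
case: s t st => [i|j] [i'|j'] st.
- apply: (reflects_map (reflects_tens i (Ru i' A B) (Ru i' V W))).
  apply: linear_comp (proj1 (reflects_tens i' (Ru i A V) (Ru i B W))).
  (* The map of sources is the interchange law at the free algebras: [dm_zeta] treats [pl],
     naturality treats [pa]. *)
  exists (zeta (duo N st) (T A) (T B) (T V) (T W)) => /=.
  split; last exact: zeta_nat.
  by rewrite !tensm_id !compm_idr !compmA (dm_zeta (gam_ll G st)).
- apply: (reflects_map
    (reflects_tens i (reflects_id (tensT (inr j') A B))
                     (reflects_id (tensT (inr j') V W)))).
  (* [bi_zeta] moves the actions past the interchange law, after which the bilinearity of the two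
     universal maps applies in each factor. *)
  have HA := proj1 (hu i A V); have HB := proj1 (hu i B W).
  rewrite /bilinear in HA HB.
  rewrite /linear /rt /= !compm_idl tensm_id compm_idr fmap_comp -!compmA.
  rewrite (compm2 _ (colax_nat (gamr G j') _ _)) -!compmA.
  rewrite (compmA (colax _ _ _)) -(bi_zeta (gam_lr G st)) -!compmA.
  rewrite (compm2 _ (esym (tensm_comp _ _ _ _ _))).
  rewrite (compm2 _ (esym (tensm_comp _ _ _ _ _))).
  rewrite !compmA HA HB (tensm_comp _ (u i A V)) -!compmA.
  by rewrite (compm2 _ (esym (zeta_nat _ _ _ _ _))) -!compmA -tensm_comp.
- by have := unsplit_rl i' j; rewrite st.
(* By [dc_zeta] the interchange law of C is itself a morphism for the tensor product actions. *)
- have H : zeta (duo N st) A B V W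
      ∘ act (tensT (inr j) (tensT (inr j') A B) (tensT (inr j') V W)) =
    act (tensT (inr j') (tensT (inr j) A V) (tensT (inr j) B W))
      ∘ fmap T (zeta (duo N st) A B V W).
    rewrite /= tensm_comp -!compmA (compm2 _ (zeta_nat _ _ _ _ _)) -!compmA.
    rewrite [zeta _ _ _ _ _ ∘ _]compmA (dc_zeta (gam_rr G st)).
    by rewrite !compmA -!tensm_comp.
  exists (@AlgHom _ _ (tensT (inr j) (tensT (inr j') A B) (tensT (inr j') V W))
    (tensT (inr j') (tensT (inr j) A V) (tensT (inr j) B W)) _ H).
  by rewrite /lifts /rt /= !tensm_id !compm_idl !compm_idr.
Qed.

(** A morphism out of a free algebra may be prescribed on generators, so compatibility with the
    actions is at stake only when both labels are comonoidal. The same holds for [nu]. *)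
Lemma lift_delta (s t : 'I_p + 'I_q) (st : unsplit s < unsplit t) :
  exists h : hom (IT s) (tensT t (IT s) (IT s)),
    lifts (unit_map s) (rt N tens_map t (unit_map s) (unit_map s))
      (delta (duo N st)) h.
Proof.
case: s st => [i|j] st.
  exact: (reflects_map (reflects_discrete _) (linear_discrete _)).
case: t st => [i'|j'] st; first by have := unsplit_rl i' j; rewrite st.
have H := dc_delta (gam_rr G st).
exists (@AlgHom _ _ (IT (inr j)) (tensT (inr j') (IT (inr j)) (IT (inr j))) _ H).
by rewrite /lifts /rt /= tensm_id !compm_idl compm_idr.
Qed.

(** By [lax_eta], a tensor product of discrete presentations imposes no condition: morphisms out of
    a tensor product of free algebras may be prescribed on generators. *)
Lemma linear_discrete_tens (i : 'I_p) (A B : C) (V : algebra T)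
    (f : hom (tens (inl i) A B) V) :
  linear (bf_pres (F i) (discrete_pres T A) (discrete_pres T B)) f.
Proof.
rewrite /linear /= lax_eta tensm_id compm_idr -compmA -eta_nat.
by rewrite compmA act_eta compm_idl.
Qed.

Lemma lift_theta (s t : 'I_p + 'I_q) (st : unsplit s < unsplit t) :
  exists h : hom (tensT s (IT t) (IT t)) (IT t),
    lifts (rt N tens_map s (unit_map t) (unit_map t)) (unit_map t)
      (theta (duo N st)) h.
Proof.
case: s t st => [i|j] [i'|j'] st.
- exact: (reflects_map (reflects_tens i (reflects_discrete _)
    (reflects_discrete _)) (linear_discrete_tens _)).
- apply: (reflects_map (reflects_tens i (reflects_id (IT (inr j')))
    (reflects_id (IT (inr j'))))).
  rewrite /linear /= tensm_id compm_idr compm_idl.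
  exact: bi_theta (gam_lr G st).
- by have := unsplit_rl i' j; rewrite st.
- have H : theta (duo N st) ∘ act (tensT (inr j) (IT (inr j')) (IT (inr j'))) =
    act (IT (inr j')) ∘ fmap T (theta (duo N st)).
    by rewrite /= compmA -(dc_theta (gam_rr G st)).
  exists (@AlgHom _ _ (tensT (inr j) (IT (inr j')) (IT (inr j')))
    (IT (inr j')) _ H).
  by rewrite /lifts /rt /= tensm_id !compm_idl compm_idr.
Qed.

Lemma lift_nu (s t : 'I_p + 'I_q) (st : unsplit s < unsplit t) :
  exists h : hom (IT s) (IT t),
    lifts (unit_map s) (unit_map t) (nu (duo N st)) h.
Proof.
case: s st => [i|j] st.
  exact: (reflects_map (reflects_discrete _) (linear_discrete _)).
case: t st => [i'|j'] st; first by have := unsplit_rl i' j; rewrite st.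
have H := esym (dc_nu (gam_rr G st)).
exists (@AlgHom _ _ (IT (inr j)) (IT (inr j')) _ H).
by rewrite /lifts /= compm_idl compm_idr.
Qed.

(* Every structure morphism of C^T restricts, along the maps of [lift_class], to
   the corresponding one of C: the descriptions of the context for i <= p and
   for i > p in a single form. *)
Record lifts_structure
    (NT : n_monoidal (C := EM T) (@unsplit p q) (alg_tens G tp) (alg_unit G))
    : Prop := LiftsStructure {
  EM_tensmE : forall (s : 'I_p + 'I_q) (V V' W W' : EM T) (f : hom V V')
      (g : hom W W'),
    alg_map (tensm (mon NT s) f g) ∘ tens_map s V W =
    tens_map s V' W' ∘ (alg_map f ⊗[mon N s] alg_map g);
  EM_assocE : forall (s : 'I_p + 'I_q) (V W Z : EM T),
    alg_map (assoc (mon NT s) V W Z)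
      ∘ rt N tens_map s (tens_map s V W) (idm (carrier Z)) =
    rt N tens_map s (idm (carrier V)) (tens_map s W Z)
      ∘ assoc (mon N s) (carrier V) (carrier W) (carrier Z);
  EM_lunitE : forall (s : 'I_p + 'I_q) (V : EM T),
    alg_map (lunit (mon NT s) V)
      ∘ rt N tens_map s (unit_map s) (idm (carrier V)) =
    idm (carrier V) ∘ lunit (mon N s) (carrier V);
  EM_runitE : forall (s : 'I_p + 'I_q) (V : EM T),
    alg_map (runit (mon NT s) V)
      ∘ rt N tens_map s (idm (carrier V)) (unit_map s) =
    idm (carrier V) ∘ runit (mon N s) (carrier V);
  EM_zetaE : forall (s t : 'I_p + 'I_q) (st : unsplit s < unsplit t)
      (A B V W : EM T),
    alg_map (zeta (duo NT st) A B V W)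
      ∘ rt N tens_map s (tens_map t A B) (tens_map t V W) =
    rt N tens_map t (tens_map s A V) (tens_map s B W)
      ∘ zeta (duo N st) (carrier A) (carrier B) (carrier V) (carrier W);
  EM_deltaE : forall (s t : 'I_p + 'I_q) (st : unsplit s < unsplit t),
    alg_map (delta (duo NT st)) ∘ unit_map s =
    rt N tens_map t (unit_map s) (unit_map s) ∘ delta (duo N st);
  EM_thetaE : forall (s t : 'I_p + 'I_q) (st : unsplit s < unsplit t),
    alg_map (theta (duo NT st)) ∘ rt N tens_map s (unit_map t) (unit_map t) =
    unit_map t ∘ theta (duo N st);
  EM_nuE : forall (s t : 'I_p + 'I_q) (st : unsplit s < unsplit t),
    alg_map (nu (duo NT st)) ∘ unit_map s = unit_map t ∘ nu (duo N st)
}.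

Lemma lifts_structure_exists : exists NT, lifts_structure NT.
Proof.
(* The lifts are known only to exist, whereas an n-monoidal structure consists of data; they are
   selected by a description principle. *)
pose cid := constructive_indefinite_description.
exists (EM_n_monoidal lift_class_inj lift_class_id lift_class_unit
  lift_class_tens lift_class_lt
  (fun s V V' W W' f g => cid _ _ (lift_tensm s f g))
  (fun s V W Z => cid _ _ (lift_assoc s V W Z))
  (fun s V => cid _ _ (lift_lunit s V))
  (fun s V => cid _ _ (lift_runit s V))
  (fun s t st A B V W => cid _ _ (lift_zeta st A B V W))
  (fun s t st => cid _ _ (lift_delta st))
  (fun s t st => cid _ _ (lift_theta st))
  (fun s t st => cid _ _ (lift_nu st))).
split.
- by move=> s V V' W W' f g; exact: (svalP (cid _ _ (lift_tensm s f g))).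
- by move=> s V W Z; exact: (proj2 (svalP (cid _ _ (lift_assoc s V W Z)))).
- by move=> s V; exact: (proj2 (svalP (cid _ _ (lift_lunit s V)))).
- by move=> s V; exact: (proj2 (svalP (cid _ _ (lift_runit s V)))).
- by move=> s t st A B V W; exact: (svalP (cid _ _ (lift_zeta st A B V W))).
- by move=> s t st; exact: (svalP (cid _ _ (lift_delta st))).
- by move=> s t st; exact: (svalP (cid _ _ (lift_theta st))).
- by move=> s t st; exact: (svalP (cid _ _ (lift_nu st))).
Qed.

(** * Agreement with the prescribed descriptions of the structure *)

Lemma bilinear_alg (i : 'I_p) (V W Z : algebra T)
    (g : alg_hom (tp i V W) Z) :
  bilinear (gaml G i) (alg_map g ∘ u i V W).
Proof.
apply/linear_bilinear; apply: linear_alg; apply/linear_bilinear.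
exact: proj1 (hu i V W).
Qed.

(** Inserting [mu ∘ T eta] and [act ∘ eta] and using bilinearity recovers [f] from its restriction
    to [A ⊗ V]. This turns the restriction of a unitor into its explicit formula. *)
Lemma bilinear_free_l (i : 'I_p) (A : C) (V Z : algebra T)
    (f : hom (tens (inl i) (free_alg T A) V) Z) :
  bilinear (gaml G i) f ->
  f = act Z ∘ fmap T (f ∘ (eta T A ⊗[mon N (inl i)] idm (carrier V)))
        ∘ lax (gaml G i) A V ∘ (idm (T A) ⊗[mon N (inl i)] eta T V).
Proof.
rewrite /bilinear /= => Hf.
rewrite fmap_comp -!compmA (compm2 _ (esym (lax_nat _ _ _))) -!compmA.
rewrite (compm3 _ Hf) -!compmA -!tensm_comp fmap_id compm_idl compm_idr.
by rewrite mu_eta_r act_eta tensm_id compm_idr.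
Qed.

Lemma bilinear_free_r (i : 'I_p) (A : C) (V Z : algebra T)
    (f : hom (tens (inl i) V (free_alg T A)) Z) :
  bilinear (gaml G i) f ->
  f = act Z ∘ fmap T (f ∘ (idm (carrier V) ⊗[mon N (inl i)] eta T A))
        ∘ lax (gaml G i) V A ∘ (eta T V ⊗[mon N (inl i)] idm (T A)).
Proof.
rewrite /bilinear /= => Hf.
rewrite fmap_comp -!compmA (compm2 _ (esym (lax_nat _ _ _))) -!compmA.
rewrite (compm3 _ Hf) -!compmA -!tensm_comp fmap_id compm_idl compm_idr.
by rewrite mu_eta_r act_eta tensm_id compm_idr.
Qed.

(** Both algebras reflect the tensor product of two discrete presentations, which gives [k]; the
    morphism induced by [lax] has the same restriction, by [lax_eta], and so equals [k]. *)
Lemma free_tens_iso_exists (i : 'I_p) (A B : C) :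
  exists2 k : alg_hom (tp i (free_alg T A) (free_alg T B))
                      (free_alg T (tens (inl i) A B)),
    free_tens_iso (gaml G i) (u i (free_alg T A) (free_alg T B)) k &
    alg_map k ∘ (u i (free_alg T A) (free_alg T B)
                   ∘ (eta T A ⊗[mon N (inl i)] eta T B)) =
      eta T (tens (inl i) A B).
Proof.
have R1 := reflects_tens i (reflects_discrete A) (reflects_discrete B).
have R2 := reflects_eta (@linear_discrete_tens i A B).
have [k Ik Hk] := reflects_unique R1 R2.
exists k => //; split => //.
have Hlax : bilinear (gaml G i) (Z := free_alg T (tens (inl i) A B))
    (lax (gaml G i) A B : hom (tens (inl i) (free_alg T A) (free_alg T B)) _).
  exact: lax_mu.
have [m [Hm _]] := proj2 (hu i (free_alg T A) (free_alg T B)) _ _ Hlax.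
suff <- : m = k by [].
by apply: (reflects_inj R1); rewrite Hk compmA Hm lax_eta.
Qed.

Context (NT : n_monoidal (C := EM T) (@unsplit p q) (alg_tens G tp) (alg_unit G)).
Context (HNT : lifts_structure NT).

Lemma lifted_l_of (i : 'I_p) : lifted_monoidal_l u NT i.
Proof.
split.
- by move=> V V' W W' f g; exact: (EM_tensmE HNT (inl i)).
- by move=> V W Z; rewrite -[LHS]compmA; exact: (EM_assocE HNT (inl i) V W Z).
- move=> V; rewrite [LHS](bilinear_free_l (bilinear_alg _)) -[X in fmap T X]compmA.
  congr (_ ∘ fmap T _ ∘ _ ∘ _).
  exact: etrans (EM_lunitE HNT (inl i) V) (compm_idl _).
- move=> V; rewrite [LHS](bilinear_free_r (bilinear_alg _)) -[X in fmap T X]compmA.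
  congr (_ ∘ fmap T _ ∘ _ ∘ _).
  exact: etrans (EM_runitE HNT (inl i) V) (compm_idl _).
Qed.

(** For comonoidal labels the restriction maps are built from tensor products of identities, which
    are identities only through [tensm_id]; hence the equations on [e] and [e']. *)
Lemma comp_idm_eq (A B : C) (e : hom A A) (e' : hom B B) (f g : hom A B) :
  e = idm A -> e' = idm B -> f ∘ e = e' ∘ g -> f = g.
Proof. by move=> -> ->; rewrite compm_idl compm_idr. Qed.

Lemma rt_idm (j : 'I_q) (V W : EM T) :
  rt N tens_map (inr j) (idm (carrier V)) (idm (carrier W)) =
  idm (tens (inr j) (carrier V) (carrier W)).
Proof. by rewrite /rt tensm_id compm_idl. Qed.

Lemma lifted_r_of (j : 'I_q) : lifted_monoidal_r NT j.
Proof.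
have rtE := rt_idm j; split.
- move=> V V' W W' f g.
  exact: comp_idm_eq erefl erefl (EM_tensmE HNT (inr j) f g).
- move=> V W Z.
  exact: comp_idm_eq (rtE (tensT (inr j) V W) Z) (rtE V (tensT (inr j) W Z))
    (EM_assocE HNT (inr j) V W Z).
- move=> V.
  exact: comp_idm_eq (rtE (IT (inr j)) V) erefl (EM_lunitE HNT (inr j) V).
- move=> V.
  exact: comp_idm_eq (rtE V (IT (inr j))) erefl (EM_runitE HNT (inr j) V).
Qed.

(** Algebra morphisms with equal restrictions along a reflection coincide. This gives the uniqueness
    of the interchange law and identifies the unit maps with the images under T of those of C, with
    [k] inserted for [delta] and [theta]. *)
Lemma lifted_ll_of (i j : 'I_p) (st : unsplit (inl i) < unsplit (inl j)) :
  lifted_duoidal_ll u NT st.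
Proof.
have Ru V W i' := proj1 (universal_reflects _) (hu i' V W).
split.
- move=> A B V W.
  have H := EM_zetaE HNT st A B V W; rewrite /rt /= compmA in H.
  split=> // z Hz.
  apply: (reflects_inj (reflects_tens i (Ru A B j) (Ru V W j))).
  by rewrite !compmA Hz H.
- have [k Ik Hk] := free_tens_iso_exists j (I (inl i)) (I (inl i)).
  exists k; split => //.
  have H := EM_deltaE HNT st; rewrite /rt /= in H.
  have E : alg_comp k (delta (duo NT st)) = free_map T (delta (duo N st)).
    apply: (reflects_inj (reflects_discrete _)).
    by rewrite /= -compmA H compmA Hk -eta_nat.
  exact: (congr1 (@alg_map _ _ _ _) E).
- have [k Ik Hk] := free_tens_iso_exists i (I (inl j)) (I (inl j)).
  exists k; split => //.
  have H := EM_thetaE HNT st; rewrite /rt /= in H.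
  have E : theta (duo NT st) = alg_comp (free_map T (theta (duo N st))) k.
    apply: (reflects_inj (reflects_tens i (reflects_discrete _)
      (reflects_discrete _))).
    by rewrite H /= -[RHS]compmA Hk eta_nat.
  exact: (congr1 (@alg_map _ _ _ _) E).
- have E : nu (duo NT st) = free_map T (nu (duo N st)).
    apply: (reflects_inj (reflects_discrete _)).
    by have := EM_nuE HNT st; rewrite /= => ->; rewrite eta_nat.
  exact: (congr1 (@alg_map _ _ _ _) E).
Qed.

Lemma lifted_lr_of (i : 'I_p) (j : 'I_q)
    (st : unsplit (inl i) < unsplit (inr j)) :
  lifted_duoidal_lr u NT st.
Proof.
split.
- move=> A B V W.
  have H := EM_zetaE HNT st A B V W.
  rewrite /rt /= tensm_id compm_idl compm_idr in H.
  split=> // z Hz; apply: (reflects_inj (proj1 (universal_reflects _) (hu i _ _))).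
  by rewrite Hz H.
- have E : delta (duo NT st) = alg_comp (colax_alg (gamr G j) _ _)
      (free_map T (delta (duo N st))).
    apply: (reflects_inj (reflects_discrete _)).
    have := EM_deltaE HNT st; rewrite /rt /= compm_idl => ->.
    by rewrite -[RHS]compmA -eta_nat compmA colax_eta.
  exact: (congr1 (@alg_map _ _ _ _) E).
- have := EM_thetaE HNT st; rewrite /rt /= tensm_id compm_idl.
  by rewrite compm_idr.
- have E : nu (duo NT st) = alg_comp (colax0_alg (gamr G j))
      (free_map T (nu (duo N st))).
    apply: (reflects_inj (reflects_discrete _)).
    have := EM_nuE HNT st; rewrite /= compm_idl => ->.
    by rewrite -compmA -eta_nat compmA colax0_eta compm_idl.
  exact: (congr1 (@alg_map _ _ _ _) E).
Qed.

Lemma lifted_rr_of (i j : 'I_q) (st : unsplit (inr i) < unsplit (inr j)) :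
  lifted_duoidal_rr NT st.
Proof.
split.
- move=> A B V W.
  exact: comp_idm_eq (rt_idm i (tensT (inr j) A B) (tensT (inr j) V W))
    (rt_idm j (tensT (inr i) A V) (tensT (inr i) B W)) (EM_zetaE HNT st A B V W).
- exact: comp_idm_eq erefl (rt_idm j (IT (inr i)) (IT (inr i)))
    (EM_deltaE HNT st).
- exact: comp_idm_eq (rt_idm i (IT (inr j)) (IT (inr j))) erefl
    (EM_thetaE HNT st).
- exact: comp_idm_eq erefl erefl (EM_nuE HNT st).
Qed.

Lemma lifts_structure_lifted : lifted_structure u NT.
Proof.
split; [exact: lifted_l_of|exact: lifted_r_of|exact: lifted_ll_of
  |exact: lifted_lr_of|exact: lifted_rr_of].
Qed.

End Lifting.

Theorem theorem8p1 (p q : nat) (C : category)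
    (tens : 'I_p + 'I_q -> C -> C -> C) (I : 'I_p + 'I_q -> C)
    (N : n_monoidal (@unsplit p q) tens I)
    (T : monad C) (G : pq_monoidal_monad N T)
    (hC : has_reflexive_coequalizers C)
    (hT : preserves_reflexive_coequalizers T)
    (hl : forall (i : 'I_p) (A : C),
       preserves_reflexive_coequalizers (ltens (mon N (inl i)) A))
    (hr : forall (i : 'I_p) (A : C),
       preserves_reflexive_coequalizers (rtens (mon N (inl i)) A)) :
  (forall (i : 'I_p) (V W : algebra T),
     exists (Z : algebra T) (u : hom (tens (inl i) V W) Z),
       universal_bilinear (gaml G i) u) /\
  (forall (tp : 'I_p -> algebra T -> algebra T -> algebra T)
          (u : forall (i : 'I_p) (V W : algebra T),
             hom (tens (inl i) V W) (tp i V W)),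
     (forall (i : 'I_p) (V W : algebra T),
        universal_bilinear (gaml G i) (u i V W)) ->
     exists NT : n_monoidal (C := EM T) (@unsplit p q)
                   (alg_tens G tp) (alg_unit G),
       lifted_structure u NT).
Proof.
split=> [i V W|tp u hu]; first exact: universal_bilinear_exists hC hT i V W.
have [NT HNT] := lifts_structure_exists hC hT hl hr hu.
by exists NT; apply: lifts_structure_lifted HNT.
Qed.
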